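(* For $0<\beta\le n$, there exists a constant $C>0$, depending only on $\beta$ and $n$, such that for $f\in\mathrm{BMO}^\beta(Q)$ $$\|\mathcal{M}f\|_{\mathrm{BLO}^\beta(Q)}\le C\,\|f\|_{\mathrm{BMO}^\beta(Q)},$$ where $Q$ is either a finite cube or $\mathbb{R}^n$.
   Context: All cubes are open cubes in $\mathbb{R}^n$ with sides parallel to the coordinate axes; $\ell(Q)$ is the side length of $Q$. Uncentered Hardy–Littlewood maximal function: $\mathcal{M}f(x)=\sup_{Q'\ni x}\ell(Q')^{-n}\int_{Q'}|f(y)|\,dy$, where the supremum is over all open cubes $Q'\subset\mathbb{R}^n$ containing $x$. Dyadic Hausdorff content: with $\mathcal{D}_0=\{2^k(l+[0,1)^n):k\in\mathbb{Z},\,l\in\mathbb{Z}^n\}$, for $E\subset\mathbb{R}^n$, $\mathcal{H}_\infty^\beta(E)=\inf\{\sum_{i=1}^\infty\ell(Q_i)^\beta: E\subset\bigcup_i Q_i,\ Q_i\in\mathcal{D}_0\}$. For $f:\Omega\to[0,\infty]$, the Choquet integral is $\int_\Omega f\,d\mathcal{H}_\infty^\beta=\int_0^\infty\mathcal{H}_\infty^\beta(\{x\in\Omega:f(x)>t\})\,dt$. For $\Omega\subset\mathbb{R}^n$ open, $f:\Omega\to\mathbb{R}$ is $\mathcal{H}_\infty^\beta$-quasicontinuous on $\Omega$ if for every $\epsilon>0$ there is an open set $O_\epsilon\subset\Omega$ with $\mathcal{H}_\infty^\beta(O_\epsilon)<\epsilon$ and $f|_{\Omega\setminus O_\epsilon}$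 continuous. $L^1(\mathcal{H}_\infty^\beta,\Omega)$ is the set of $\mathcal{H}_\infty^\beta$-quasicontinuous $f$ on $\Omega$ with $\int_\Omega|f|\,d\mathcal{H}_\infty^\beta<\infty$. For a cube $Q$, $\mathrm{BMO}^\beta(Q)$ is the set of $f\in L^1(\mathcal{H}_\infty^\beta,Q)$ with $$\|f\|_{\mathrm{BMO}^\beta(Q)}=\sup_{Q'}\inf_{c\in\mathbb{R}}\frac{1}{\mathcal{H}_\infty^\beta(Q')}\int_{Q'}|f-c|\,d\mathcal{H}_\infty^\beta<\infty,$$ where the supremum is over all finite subcubes $Q'$ of $Q$ parallel to $Q$. For a function $g$ and $A\subset\mathbb{R}^n$, put $\operatorname{ess\,inf}_{\beta,A}\,g=\sup\{c\in\mathbb{R}:\mathcal{H}_\infty^\beta(\{x\in A:g(x)<c\})=0\}$. Then $\mathrm{BLO}^\beta(Q)$ is the set of real-valued $g\in L^1(\mathcal{H}_\infty^\beta,Q)$ with $$\|g\|_{\mathrm{BLO}^\beta(Q)}=\sup_{Q'}\frac{1}{\mathcal{H}_\infty^\beta(Q')}\int_{Q'}\big(g-\operatorname{ess\,inf}_{\beta,Q'}\,g\big)\,d\mathcal{H}_\infty^\beta<\infty,$$ where the supremum is over the same subcubes. The spaces $\mathrm{BMO}^\beta(\mathbb{R}^n)$ and $\mathrm{BLO}^\beta(\mathbb{R}^n)$ are defined analogously, taking the supremum over all cubes in $\mathbb{R}^n$. *)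

(* Defs.v *)
From HB Require Import structures.
From mathcomp Require Import all_boot all_order all_algebra.
From mathcomp Require Import all_classical all_reals all_analysis.

Set Implicit Arguments.
Unset Strict Implicit.
Unset Printing Implicit Defensive.
Import Order.TTheory GRing.Theory Num.Theory.
Import numFieldNormedType.Exports.
Local Open Scope classical_set_scope.
Local Open Scope ring_scope.

(* The product (Borel) sigma-algebra on R^n = 'rV[R]_n. *)
Section row_measurable.
Context {R : realType} (n : nat).

Definition row_coord (i : 'I_n) (x : 'rV[R]_n) : measurableTypeR R := x ord0 i.

Let row_set0 : g_sigma_preimage row_coord set0.
Proof. exact: sigma_algebra0. Qed.

Let row_setC A : g_sigma_preimage row_coord A ->
  g_sigma_preimage row_coord (~` A).
Proof. exact: sigma_algebraC. Qed.

Let row_bigcup (F : _^nat) : (forall i, g_sigma_preimage row_coord (F i)) ->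
  g_sigma_preimage row_coord (\bigcup_i (F i)).
Proof. exact: sigma_algebra_bigcup. Qed.

HB.instance Definition _ :=
  @isMeasurable.Build default_measure_display 'rV[R]_n
    (g_sigma_preimage row_coord) row_set0 row_setC row_bigcup.

Lemma measurable_row_coord i : measurable_fun setT (row_coord i).
Proof.
move=> _ Y mY; rewrite setTI; apply: sub_sigma_algebra => /=.
rewrite -bigcup_seq/=; exists i => /=; first by rewrite mem_index_enum.
by exists Y => //; rewrite setTI.
Qed.

Lemma measurable_fun_row d (T : measurableType d) (f : T -> 'rV[R]_n) :
  (forall i, measurable_fun setT (row_coord i \o f)) -> measurable_fun setT f.
Proof.
move=> mf _ A mA; rewrite setTI.
suff: g_sigma_preimage (fun i => row_coord i \o f) `<=` measurable.
  apply; rewrite g_sigma_preimage_comp; exists A => //; exact: setTI.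
apply: smallest_sub; first exact: sigma_algebra_measurable.
rewrite -bigcup_seq; apply: bigcup_sub => i _ _ [B mB <-].
exact: mf.
Qed.

End row_measurable.

Section lebesgue_Rn.
Context {R : realType}.
Local Open Scope ereal_scope.

Definition row_cons n (p : measurableTypeR R * 'rV[R]_n) : 'rV[R]_n.+1 :=
  \row_i if unlift ord0 i is Some j then p.2 ord0 j else p.1.

Lemma measurable_row_cons n : measurable_fun setT (@row_cons n).
Proof.
apply: measurable_fun_row => i.
rewrite (_ : _ \o _ = fun p => if unlift ord0 i is Some j
    then row_coord j p.2 else p.1); last first.
  by apply/funext => p; rewrite /row_coord /row_cons /= mxE.
case: (unlift _ _) => [j|]; last exact: measurable_fst.
exact: (measurableT_comp (measurable_row_coord j) measurable_snd).
Qed.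

Section step.
Context n (mu : {sigma_finite_measure set 'rV[R]_n -> \bar R}).

Definition lebesgue_step : set 'rV[R]_n.+1 -> \bar R :=
  pushforward (@lebesgue_measure R \x mu) (@row_cons n).

Let pushforward_row_cons : {measure set 'rV[R]_n.+1 -> \bar R} :=
  measure_function_pushforward__canonical__measure_function_Measure
    (@lebesgue_measure R \x mu) (@measurable_row_cons n).

HB.instance Definition _ := isMeasure.Build _ _ _ lebesgue_step
  (measure0 pushforward_row_cons) (measure_ge0 pushforward_row_cons)
  (@measure_semi_sigma_additive _ _ _ pushforward_row_cons).

Let lebesgue_step_sigma_finite : sigma_finite setT lebesgue_step.
Proof.
pose g (x : 'rV[R]_n.+1) : measurableTypeR R * 'rV[R]_n :=
  (row_coord ord0 x, \row_i x ord0 (lift ord0 i)).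
have gK : cancel (@row_cons n) g.
  move=> [a v]; rewrite /g /row_cons /row_coord mxE unlift_none; congr (_, _).
  by apply/rowP => i; rewrite !mxE liftK.
have mg : measurable_fun setT g.
  apply: measurable_fun_pair; first exact: measurable_row_coord.
  apply: measurable_fun_row => i.
  rewrite (_ : _ \o _ = row_coord (lift ord0 i)); last first.
    by apply/funext => x; rewrite /row_coord /= mxE.
  exact: measurable_row_coord.
have [F FT mF] : sigma_finite setT (@lebesgue_measure R \x mu).
  have /sigma_finiteP[F [TF ndF Foo]] := sigma_finiteT (@lebesgue_measure R).
  have /sigma_finiteP[G [TG ndG Goo]] := sigma_finiteT mu.
  exists (fun k => F k `*` G k).
    rewrite -setXTT TF TG predeqE => -[x y]; split.
      move=> [/= [k _ Fkx] [l _ Gly]]; exists (maxn k l) => //; split.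
      - by move: x Fkx; exact/subsetPset/ndF/leq_maxl.
      - by move: y Gly; exact/subsetPset/ndG/leq_maxr.
    by move=> [k _ []/= ? ?]; split; exists k.
  move=> k; have [? ?] := Foo k; have [? ?] := Goo k.
  split; first exact: measurableX.
  by rewrite product_measure1E// lte_mul_pinfty// ge0_fin_numE.
exists (fun k => g @^-1` F k).
  by rewrite -preimage_bigcup -FT preimage_setT.
move=> k; have [mFk Fk] := mF k; split.
  by rewrite -[_ @^-1` _]setTI; exact: mg.
rewrite /lebesgue_step /pushforward -comp_preimage.
by rewrite (_ : g \o _ = id) ?preimage_id//; exact/funext.
Qed.

HB.instance Definition _ := Measure_isSigmaFinite.Build _ _ _ lebesgue_step
  lebesgue_step_sigma_finite.

End step.

(* Lebesgue measure on the Borel sets of R^n, as an iterated product. *)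
Fixpoint borel_lebesgue n : {sigma_finite_measure set 'rV[R]_n -> \bar R} :=
  match n with
  | 0 => \d_(0%R : 'rV[R]_0)
  | n'.+1 => lebesgue_step (borel_lebesgue n')
  end.

(* Its completion, defined on the Lebesgue sigma-algebra. *)
Definition lebesgue_rV n :=
  @completed_measure_extension _ _ R (@borel_lebesgue n).

HB.instance Definition _ n := Measure.on (@lebesgue_rV n).

End lebesgue_Rn.

Arguments lebesgue_rV {R} n.

Section content_spaces.
Context {R : realType} {n : nat}.
Implicit Types (beta : R) (Omega A : set 'rV[R]_n) (Q : 'rV[R]_n * R).
Local Open Scope ereal_scope.

(* A cube is given by its lower corner and its side length. *)
Definition cube Q : set 'rV[R]_n :=
  [set x | forall i, (Q.1 ord0 i < x ord0 i < Q.1 ord0 i + Q.2)%R].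

Definition maximal (f : 'rV[R]_n -> R) (x : 'rV[R]_n) : \bar R :=
  ereal_sup [set (Q.2 ^- n)%:E * \int[lebesgue_rV n]_(y in cube Q) `|f y|%:E
    | Q in [set Q | (0 < Q.2)%R /\ cube Q x]].

Definition dyadic_cube (D : int * 'rV[int]_n) : set 'rV[R]_n :=
  [set x | forall i, (2 ^ D.1 * (D.2 ord0 i)%:~R <= x ord0 i
                      < 2 ^ D.1 * ((D.2 ord0 i)%:~R + 1))%R].

Definition dyadic_content beta (E : set 'rV[R]_n) : \bar R :=
  ereal_inf [set \sum_(i <oo) ((2 ^ (D i).1) `^ beta)%:E
    | D in [set D : nat -> int * 'rV[int]_n |
             E `<=` \bigcup_i dyadic_cube (D i)]].

Definition choquet beta Omega (f : 'rV[R]_n -> \bar R) : \bar R :=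
  \int[@lebesgue_measure R]_(t in `[0%R, +oo[)
    dyadic_content beta [set x | Omega x /\ t%:E < f x].

(* In this and the following definitions only the restriction of f to Omega
   matters: a function on Omega is represented by a function on R^n. *)
Definition quasicontinuous beta Omega (f : 'rV[R]_n -> R) :=
  forall eps : R, (0 < eps)%R -> exists O : set 'rV[R]_n,
    [/\ open O, O `<=` Omega, dyadic_content beta O < eps%:E &
      {within Omega `\` O, continuous f}].

Definition L1_content beta Omega (f : 'rV[R]_n -> R) :=
  quasicontinuous beta Omega f /\
  choquet beta Omega (fun x => `|f x|%:E) < +oo.

Definition subcubes Omega : set ('rV[R]_n * R) :=
  [set Q | (0 < Q.2)%R /\ cube Q `<=` Omega].

Definition BMO_norm beta Omega (f : 'rV[R]_n -> R) : \bar R :=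
  ereal_sup [set ereal_inf [set (dyadic_content beta (cube Q))^-1 *
      choquet beta (cube Q) (fun x => `|f x - c|%:E) | c in [set: R]]
    | Q in subcubes Omega].

Definition BMO beta Omega : set ('rV[R]_n -> R) :=
  [set f | L1_content beta Omega f /\ BMO_norm beta Omega f < +oo].

Definition ess_inf_content beta A (g : 'rV[R]_n -> \bar R) : \bar R :=
  ereal_sup [set c%:E | c in
    [set c : R | dyadic_content beta [set x | A x /\ g x < c%:E] = 0]].

(* The maximal function may be infinite at some points, so g is extended
   real-valued. The dual subtraction satisfies +oo - +oo = +oo: a function
   whose essential infimum on some cube is +oo has infinite norm. *)
Definition BLO_norm beta Omega (g : 'rV[R]_n -> \bar R) : \bar R :=
  ereal_sup [set (dyadic_content beta (cube Q))^-1 *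
      choquet beta (cube Q) (fun x => (g x - ess_inf_content beta (cube Q) g)%dE)
    | Q in subcubes Omega].

End content_spaces.

(* Main.v *)
(* Fix a subcube Q0 of Q.  Every cube P of Q has a centre c_P with
   |f - c_P| <= K l(P)^beta in Choquet mean, K being comparable to the BMO norm,
   and since |E| <= l(P)^(n - beta) H(E) for E in P, the Lebesgue mean of |f|
   over P differs from |c_P| by at most 3K.  Thus Mf can be compared with
   sup |c_S| over the cubes S of Q containing x (a cube that leaves Q is first
   translated or shrunk into Q).

   If S is longer than Q0, then S and Q0 lie in a cube W of Q of comparable
   size, so |c_S| <= |c_W| + CK, while Mf >= |c_W| - 3K on all of Q0.  If S is
   shorter than Q0, then S lies in a cube N of Q with l(N) <= 3 l(Q0), and
   |c_S| <= |c_N| + |c_S - c_N|.  So Mf - ess inf Mf is at most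
   CK + sup |c_S - c_N|, the supremum being over x in S, S in N.

   That last supremum decays exponentially in content, as in the
   John-Nirenberg inequality: cover {|f - c_N| > MK} by dyadic cubes of small
   total weight, and stop at the maximal cells of the grid relative to N in
   which these cubes weigh at least a fixed fraction of the cell.  A cube S on
   which the covered set has content more than half of l(S)^beta lies in an
   enlarged stopping cell P, and the parent of that cell is not stopped, so
   that c_P is close to c_N; for the other cubes c_S itself is close to c_N.
   The stopping cells have small total weight, so the argument iterates.

   Choquet means control Lebesgue means through a measurable majorant of
   |f - c_P| built from dyadic covers of its level sets. *)

Require Import Defs.
From mathcomp Require Import all_boot all_order all_algebra.
From mathcomp Require Import all_classical all_reals all_analysis.
From mathcomp Require Import measurable_realfun ring lra zify.
Set Implicit Arguments.
Unset Strict Implicit.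
Unset Printing Implicit Defensive.
Import Order.TTheory GRing.Theory Num.Theory.
Import numFieldNormedType.Exports.
Local Open Scope classical_set_scope.
Local Open Scope ring_scope.

(** * Lebesgue measure of cubes and dyadic content *)

Section box_measure.
Context {R : realType}.

Definition box n (I : 'I_n -> set R) : set 'rV[R]_n :=
  [set x | forall i, I i (x ord0 i)].

Lemma measurable_box n (I : 'I_n -> set R) :
  (forall i, measurable (I i : set (measurableTypeR R))) ->
  measurable (box I).
Proof.
move=> mI.
rewrite (_ : box I = \bigcap_(i in [set: 'I_n]) (row_coord i @^-1` I i)).
  apply: fin_bigcap_measurable; first exact: finite_finset.
  by move=> i _; rewrite -[_ @^-1` _]setTI; exact: measurable_row_coord.
by apply/seteqP; split=> x /= h => [i _|i]; apply: h.
Qed.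

Lemma borel_lebesgue_box (s : R) n (I : 'I_n -> set R) :
  (forall i, measurable (I i : set (measurableTypeR R))) ->
  (forall i, lebesgue_measure (I i : set (measurableTypeR R)) = s%:E) ->
  borel_lebesgue n (box I) = (s ^+ n)%:E.
Proof.
elim: n I => [|n IH] I mI Is.
  rewrite /= diracE expr0 (_ : _ \in _) //.
  by rewrite inE => -[].
rewrite /= /lebesgue_step /pushforward.
rewrite (_ : _ @^-1` _ = I ord0 `*` box (fun i => I (lift ord0 i))).
  rewrite product_measure1E//; last first.
    by apply: measurable_box => i; exact: mI.
  by rewrite exprS EFinM; congr (_ * _)%E; [exact: Is|exact: IH].
apply/seteqP; split=> -[a x]; rewrite /box /row_cons /=.
  move=> h; split; first by have := h ord0; rewrite mxE unlift_none.
  by move=> i; have := h (lift ord0 i); rewrite mxE liftK.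
move=> [h0 h] i; rewrite mxE.
by case: unliftP => [j ->|->].
Qed.

Lemma measurable_lebesgue_rV n (A : set 'rV[R]_n) : measurable A ->
  measurable (A : set (caratheodory_type (@borel_lebesgue R n)^*%mu)).
Proof. by move=> mA; apply: sub_caratheodory; exact: sub_sigma_algebra. Qed.

Lemma lebesgue_rVE n (A : set 'rV[R]_n) : measurable A ->
  lebesgue_rV n A = borel_lebesgue n A.
Proof. by move=> mA; rewrite /lebesgue_rV /completed_measure_extension measurable_mu_extE. Qed.

End box_measure.

Section cubes.
Context {R : realType} {n : nat}.
Implicit Types (Q : 'rV[R]_n * R) (D : int * 'rV[int]_n).

Definition side D : R := 2 ^ D.1.

Lemma side_gt0 D : 0 < side D.
Proof. by rewrite /side exprz_gt0. Qed.

Lemma cubeE Q : cube Q = box (fun i => `]Q.1 ord0 i, (Q.1 ord0 i + Q.2)[%classic).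
Proof. by apply/seteqP; split=> x /= h i; have := h i; rewrite /= in_itv. Qed.

Lemma dyadic_cubeE D : dyadic_cube D =
  box (fun i => `[(side D * (D.2 ord0 i)%:~R), (side D * ((D.2 ord0 i)%:~R + 1))[%classic).
Proof. by apply/seteqP; split=> x /= h i; have := h i; rewrite /= in_itv. Qed.

Lemma measurable_cube Q : measurable (cube Q).
Proof. by rewrite cubeE; apply: measurable_box => i; exact: measurable_itv. Qed.

Lemma measurable_dyadic_cube D : measurable (dyadic_cube D : set 'rV[R]_n).
Proof. by rewrite dyadic_cubeE; apply: measurable_box => i; exact: measurable_itv. Qed.

Lemma lebesgue_cube Q : 0 < Q.2 -> borel_lebesgue n (cube Q) = (Q.2 ^+ n)%:E.
Proof.
move=> Q0; rewrite cubeE (@borel_lebesgue_box _ Q.2)// => i.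
by rewrite lebesgue_measure_itv/= lte_fin ltrDl Q0 -EFinB addrAC subrr add0r.
Qed.

Lemma lebesgue_dyadic_cube D :
  borel_lebesgue n (dyadic_cube D) = (side D ^+ n)%:E.
Proof.
rewrite dyadic_cubeE (@borel_lebesgue_box _ (side D))// => i.
rewrite lebesgue_measure_itv/= lte_fin ltr_pM2l ?side_gt0// ltrDl ltr01.
by rewrite -EFinB -mulrBr addrAC subrr add0r mulr1.
Qed.

End cubes.

Lemma sub_esum (R : realType) (T : choiceType) (A B : set T) (a : T -> \bar R) :
  A `<=` B -> (forall t, (0 <= a t)%E) ->
  (\esum_(t in A) a t <= \esum_(t in B) a t)%E.
Proof.
move=> AB a0; rewrite esum_mkcond [leRHS]esum_mkcond.
apply: le_esum => t _; case: ifPn => [/set_mem/AB/mem_set->//|_].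
by case: ifPn.
Qed.

Section content.
Context {R : realType} {n : nat} (beta : R).
Hypothesis beta_gt0 : 0 < beta.
Implicit Types (Q : 'rV[R]_n * R) (D : int * 'rV[int]_n) (E F : set 'rV[R]_n).
Local Notation H := (@dyadic_content R n beta).
Local Open Scope ereal_scope.

Lemma content_ge0 E : 0 <= H E.
Proof.
apply: le_ereal_inf_tmp => _ [D _ <-].
by apply: nneseries_ge0 => i _ _; rewrite lee_fin powR_ge0.
Qed.

Lemma le_content E F : E `<=` F -> H E <= H F.
Proof.
move=> EF; apply: ereal_inf_le_tmp => x [D hD <-]; exists D => //.
exact: subset_trans hD.
Qed.

(** A cover in [dyadic_content] is a full sequence of cubes of positive side, so a cover by fewer
    cubes has to be padded with cubes of negligible weight. *)
Lemma exists_small_side (e : R) : (0 < e)%R ->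
  exists N : nat, ((2 ^ (- N%:Z)) `^ beta <= e :> R)%R.
Proof.
move=> e0.
have [N hN] : exists N : nat, (e `^ (- beta^-1) <= N%:R)%R.
  exists (Num.truncn (e `^ (- beta^-1))).+1.
  by rewrite ltW// truncnS_gt.
exists N.
have hp : (0 < e `^ (- beta^-1))%R by rewrite powR_gt0.
have hN0 : (0 < (N%:R : R))%R by exact: lt_le_trans hN.
have h2 : (2 ^ (- N%:Z) <= e `^ (beta^-1) :> R)%R.
  rewrite -[leRHS]invrK -powRN -exprnN -exprVn exprVn lef_pV2 ?posrE ?exprn_gt0//.
  apply: le_trans hN _; rewrite -natrX ler_nat.
  by apply: ltnW; exact: ltn_expl.
have h3 : ((2 ^ (- N%:Z)) `^ beta <= (e `^ (beta^-1)) `^ beta :> R)%R.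
  by apply: ge0_ler_powR; rewrite ?nnegrE ?powR_ge0 ?exprz_ge0 ?(ltW beta_gt0).
by apply: (le_trans h3); rewrite -powRrM mulVf ?gt_eqF// powRr1 ?(ltW e0).
Qed.

Lemma content_le_esum (J : countType) (X : set J) (D : J -> int * 'rV[int]_n) E :
  E `<=` \bigcup_(j in X) dyadic_cube (D j) ->
  H E <= \esum_(j in X) (side (D j) `^ beta)%:E.
Proof.
move=> ED; apply/lee_addgt0Pr => e e0.
have /(_ _)/cid-/all_sig[N hN] : forall m : nat, exists N : nat,
    ((2 ^ (- N%:Z)) `^ beta <= e / (2 ^ m.+1)%:R :> R)%R.
  by move=> m; apply: exists_small_side; rewrite divr_gt0.
pose XP := pickle @` X.
(* Index [m] carries the cube of the [j] in [X] with [pickle j = m]. The test on [pickle j] prevents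
   double counting, and the fillers at all other indices weigh at most [e] in total. *)
pose g (m : nat) := if unpickle m is Some j then
   if (j \in X) && (pickle j == m) then D j else ((- (N m)%:Z)%R, 0%R) else ((- (N m)%:Z)%R, 0%R).
pose a (m : nat) := if unpickle m is Some j then
   if (j \in X) && (pickle j == m) then (side (D j) `^ beta)%:E : \bar R else 0 else 0.
have a0 m : 0 <= a m.
  by rewrite /a; case: unpickle => // j; case: ifP => //; rewrite lee_fin powR_ge0.
apply: (@le_trans _ _ (\sum_(m <oo) ((2 ^ (g m).1) `^ beta)%:E)).
  apply: ereal_inf_lbound; exists g => //.
  apply: (subset_trans ED) => x [j Xj jx]; exists (pickle j) => //.
  by rewrite /g pickleK mem_set//= eqxx.
apply: (@le_trans _ _ (\sum_(m <oo) (a m + (e / (2 ^ m.+1)%:R)%:E))).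
  apply: lee_nneseries => [m _ _|m _]; first by rewrite lee_fin powR_ge0.
  have e2 : 0 <= (e / (2 ^ m.+1)%:R)%:E by rewrite lee_fin divr_ge0 ?ler0n ?(ltW e0).
  rewrite /g /a; case: unpickle => [j|]; last by rewrite add0e lee_fin; exact: hN.
  by case: ifP => _; [rewrite leeDl|rewrite add0e lee_fin; exact: hN].
apply: (le_trans (@epsilon_trick _ a e xpredT a0 (ltW e0))).
rewrite leeD2r// nneseries_esumT//.
rewrite (_ : \esum_(m in setT) a m = \esum_(m in XP) a m); last first.
  rewrite [RHS]esum_mkcond; apply: eq_esum => m _; case: ifPn => //.
  rewrite notin_setE /a => hm; case Eq: unpickle => [j|//]; case: ifP => // /andP[jX /eqP jm].
  by exfalso; apply: hm; exists j => //; rewrite -inE.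
rewrite (@esum_image _ _ _ X pickle a); last by move=> x y _ _; exact: (pcan_inj pickleK).
apply: le_esum => j Xj; rewrite /a pickleK mem_set//= eqxx lexx//.
Qed.

(** Countable subadditivity: covers of the pieces, optimal up to errors that sum to at most [e],
    merge into one cover indexed by pairs. *)
Lemma content_sub (J : countType) (X : set J) (E : J -> set 'rV[R]_n) F :
  F `<=` \bigcup_(j in X) E j -> H F <= \esum_(j in X) H (E j).
Proof.
move=> FE.
have [[j Xj Ej]|nE] := pselect (exists2 j, X j & H (E j) = +oo).
  rewrite (_ : \esum_(j in X) _ = +oo) ?leey//.
  apply/eqP; rewrite -leye_eq; apply: esum_ge; exists [set j].
    by split; [exact: finite_set1|move=> _ ->].
  by rewrite fsbig_set1 Ej.
have hfin j : X j -> H (E j) \is a fin_num.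
  move=> Xj; rewrite ge0_fin_numE ?content_ge0// ltey; apply/eqP => Ej.
  by apply: nE; exists j.
apply/lee_addgt0Pr => e e0.
have hD j : exists D : nat -> int * 'rV[int]_n, X j ->
   (E j `<=` \bigcup_i dyadic_cube (D i)) /\
   \sum_(i <oo) (side (D i) `^ beta)%:E <= H (E j) + (e / (2 ^ (pickle j).+1)%:R)%:E.
  have [Xj|] := pselect (X j); last by move=> ?; exists (fun=> (0%R, 0%R)).
  have e2 : (0 < e / (2 ^ (pickle j).+1)%:R)%R by rewrite divr_gt0.
  have [_ [D hD <-] hlt] := lb_ereal_inf_adherent e2 (hfin _ Xj).
  by exists D => _; split => //; exact: ltW.
have {hD}[D hD] := choice hD.
have hc : F `<=` \bigcup_(p in X `*` [set: nat]) dyadic_cube (D p.1 p.2).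
  move=> x /FE[j Xj /(hD j Xj).1[i _ ix]]; exists (j, i) => //.
apply: le_trans (content_le_esum hc) _.
rewrite -(@esum_esum _ _ _ X (fun=> setT) (fun j i => (side (D j i) `^ beta)%:E))/=; last first.
  by move=> *; rewrite lee_fin powR_ge0.
apply: (@le_trans _ _ (\esum_(j in X) (H (E j) + (e / (2 ^ (pickle j).+1)%:R)%:E))).
  apply: le_esum => j Xj; rewrite -nneseries_esumT; first exact: (hD j Xj).2.
  by move=> *; rewrite lee_fin powR_ge0.
rewrite esumD; last 2 first.
- by move=> *; exact: content_ge0.
- by move=> *; rewrite lee_fin divr_ge0 ?ler0n ?(ltW e0).
rewrite leeD2l//.
rewrite -(@esum_image _ _ _ X pickle (fun m => (e / (2 ^ m.+1)%:R)%:E)); last first.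
  by move=> x y _ _; exact: (pcan_inj pickleK).
apply: (@le_trans _ _ (\esum_(m in [set: nat]) (e / (2 ^ m.+1)%:R)%:E)).
  by apply: sub_esum => // m; rewrite lee_fin divr_ge0 ?ler0n ?(ltW e0).
rewrite -nneseries_esumT; first exact: epsilon_trick0 (ltW e0).
by move=> *; rewrite lee_fin divr_ge0 ?ler0n ?(ltW e0).
Qed.

End content.

Lemma esum_finType (R : realType) (T : finType) (a : T -> \bar R) :
  (forall t, (0 <= a t)%E) -> (\esum_(t in [set: T]) a t = \sum_(t : T) a t)%E.
Proof.
move=> a0; rewrite esum_fset; [|exact: finite_finset|by []].
rewrite (fsbigE (index_enum T)) ?index_enum_uniq//.
  by apply: eq_bigl => t; rewrite in_setT.
by move=> t _; rewrite mem_index_enum.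
Qed.

Section content_cube.
Context {R : realType} {n : nat} (beta : R).
Hypothesis beta_gt0 : 0 < beta.
Hypothesis beta_le : beta <= n%:R.
Implicit Types (Q : 'rV[R]_n * R) (D : int * 'rV[int]_n) (E F : set 'rV[R]_n).
Local Notation H := (@dyadic_content R n beta).
Local Open Scope ereal_scope.

Lemma content0 : H set0 = 0.
Proof.
apply/eqP; rewrite eq_le content_ge0 andbT.
apply: le_trans (content_le_esum (beta := beta) beta_gt0
  (X := @set0 nat) (D := fun=> (0%R, 0%R)) _) _ => //.
by rewrite esum_set0.
Qed.

Lemma contentU E F : H (E `|` F) <= H E + H F.
Proof.
have := @content_sub _ n _ beta_gt0 bool setT (fun b => if b then E else F) (E `|` F).
rewrite esum_finType; last by move=> *; exact: content_ge0.
rewrite big_bool/=; apply => x [Ex|Fx]; first by exists true.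
by exists false.
Qed.

(** Split [n] as [(n - beta) + beta], both nonnegative, and bound the minimum by [s] in the first
    power and by [d] in the second. *)
Lemma minX_le_powR (s d : R) : (0 < s)%R -> (0 < d)%R ->
  (Num.min s d ^+ n <= s `^ (n%:R - beta) * d `^ beta)%R.
Proof.
move=> s0 d0; have m0 : (0 < Num.min s d)%R by rewrite lt_min s0 d0.
rewrite -powR_mulrn ?(ltW m0)// -{1}(subrK beta n%:R) powRD; last first.
  by rewrite (gt_eqF m0) implybT.
apply: ler_pM; rewrite ?powR_ge0//.
  apply: ge0_ler_powR; rewrite ?nnegrE ?subr_ge0 ?(ltW s0) ?(ltW m0)//.
  by rewrite ge_min lexx.
apply: ge0_ler_powR; rewrite ?nnegrE ?(ltW d0) ?(ltW m0) ?(ltW beta_gt0)//.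
by rewrite ge_min lexx orbT.
Qed.

(** The passage from measure to content: a dyadic cube meets [Q] in measure at most the smaller of
    the two volumes. *)
Lemma lebesgue_cover_le Q (D : nat -> int * 'rV[int]_n) : (0 < Q.2)%R ->
  borel_lebesgue n (cube Q `&` \bigcup_i dyadic_cube (D i)) <=
  (Q.2 `^ (n%:R - beta))%:E * \sum_(i <oo) (side (D i) `^ beta)%:E.
Proof.
move=> s0.
have mD i : measurable (cube Q `&` dyadic_cube (D i)).
  by apply: measurableI; [exact: measurable_cube|exact: measurable_dyadic_cube].
have mD' : measurable (cube Q `&` \bigcup_i dyadic_cube (D i)).
  apply: measurableI; first exact: measurable_cube.
  by apply: bigcup_measurable => i _; exact: measurable_dyadic_cube.
apply: (@le_trans _ _ (\sum_(i <oo) borel_lebesgue n (cube Q `&` dyadic_cube (D i)))).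
  apply: measure_sigma_subadditive => //.
  by rewrite setI_bigcupr.
rewrite -nneseriesZl; last by move=> i _; rewrite lee_fin powR_ge0.
apply: lee_nneseries => // i _; rewrite -EFinM.
apply: le_trans (_ : (Num.min Q.2 (side (D i)) ^+ n)%:E <= _); last first.
  by rewrite lee_fin minX_le_powR// side_gt0.
have [h|h] := leP Q.2 (side (D i)).
  rewrite -lebesgue_cube//; apply: le_measure; rewrite ?inE//; exact: measurable_cube.
rewrite -lebesgue_dyadic_cube; apply: le_measure; rewrite ?inE//.
exact: measurable_dyadic_cube.
Qed.

(** A cover of [Q] has to carry its full Lebesgue measure, and [lebesgue_cover_le] turns this into a
    lower bound on the weight. *)
Lemma content_cube_ge Q : (0 < Q.2)%R -> (Q.2 `^ beta)%:E <= H (cube Q).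
Proof.
move=> s0; apply: le_ereal_inf_tmp => _ [D hD <-].
have := @lebesgue_cover_le Q D s0; rewrite setIidl// lebesgue_cube//.
have h0 : (0 < Q.2 `^ (n%:R - beta))%R by rewrite powR_gt0.
rewrite (_ : Q.2 ^+ n = Q.2 `^ (n%:R - beta) * Q.2 `^ beta)%R; last first.
  rewrite -powRD; last by rewrite (gt_eqF s0) implybT.
  by rewrite subrK powR_mulrn// ltW.
by rewrite EFinM lee_pmul2l.
Qed.

End content_cube.

(** * Grids of cells and choice of scales *)

Section grid.
Context {R : realType} {n : nat}.
Implicit Types (a p x y : 'rV[R]_n) (r s : R).

(* Address of the cell of the half-open grid with origin a and mesh r. *)
Definition adr a r x : 'rV[int]_n := \row_i Num.floor ((x ord0 i - a ord0 i) / r).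

Definition vert p s (e : {ffun 'I_n -> bool}) : 'rV[R]_n :=
  \row_i (p ord0 i + (e i)%:R * s).

Lemma floor_sandwich (u v w : R) : u <= v -> v <= w -> w <= u + 1 ->
  Num.floor v = Num.floor u \/ Num.floor v = Num.floor w.
Proof.
move=> uv vw wu; have h1 := le_floor uv; have h2 := le_floor vw.
have h3 : (Num.floor w <= Num.floor u + 1)%R.
  by apply: le_trans (le_floor wu) _; rewrite floorDrz ?rpred1// floor1.
by move: h1 h2 h3; lia.
Qed.

(** In each coordinate an interval of length at most [r] meets only the cells of its two endpoints.
    So a cell meeting the cube contains one of its vertices, and there are at most [2 ^ n] such
    cells. *)
Lemma exists_vert a r p s x : 0 < r -> s <= r ->
  (forall i, p ord0 i <= x ord0 i <= p ord0 i + s) ->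
  exists e, adr a r (vert p s e) = adr a r x.
Proof.
move=> r0 sr h.
exists [ffun i => Num.floor ((p ord0 i - a ord0 i) / r) != Num.floor ((x ord0 i - a ord0 i) / r)].
apply/rowP => i; rewrite !mxE ffunE.
case: eqP => [<-|hne]; first by rewrite mul0r addr0.
have /andP[h1 h2] := h i; rewrite mul1r.
case: (@floor_sandwich ((p ord0 i - a ord0 i) / r) ((x ord0 i - a ord0 i) / r)
  ((p ord0 i + s - a ord0 i) / r)) => //.
- by rewrite ler_pM2r ?invr_gt0// lerD2r.
- by rewrite ler_pM2r ?invr_gt0// lerD2r.
- rewrite -(divff (lt0r_neq0 r0)) -mulrDl ler_pM2r ?invr_gt0//; lra.
by move=> h3; case: hne.
Qed.

(** For a positive integer [m], the floor of [u / m] depends only on the floor of [u]. *)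
Lemma adr_nest a r (m : nat) x y : (0 < m)%N ->
  adr a r x = adr a r y -> adr a (m%:R * r) x = adr a (m%:R * r) y.
Proof.
move=> m0 h.
have le2 (u v : R) : Num.floor u = Num.floor v ->
    Num.floor (u / m%:R) <= Num.floor (v / m%:R).
  move=> uv; rewrite floor_ge_int ler_pdivlMr ?ltr0n//.
  rewrite -[m%:R]/((m%:Z)%:~R) -intrM -floor_ge_int -uv floor_ge_int intrM.
  by rewrite -ler_pdivlMr ?ltr0n// floor_le.
apply/rowP => i; have := congr1 (fun z : 'rV_n => z ord0 i) h.
rewrite !mxE !invfM !(mulrC m%:R^-1) !mulrA => uv.
by apply/eqP; rewrite eq_le !le2.
Qed.

Lemma adrP a r x i : 0 < r ->
  a ord0 i + r * (adr a r x ord0 i)%:~R <= x ord0 i < a ord0 i + r * ((adr a r x ord0 i)%:~R + 1).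
Proof.
move=> r0; rewrite mxE.
have h1 := floor_le ((x ord0 i - a ord0 i) / r).
have h2 := floorD1_gt ((x ord0 i - a ord0 i) / r).
rewrite ler_pdivlMr// in h1; rewrite ltr_pdivrMr// in h2.
rewrite intrD in h2; lra.
Qed.

Lemma mem_dyadic_cube (k : int) x : dyadic_cube (k, adr 0 (2 ^ k) x) x.
Proof.
move=> i; have := @adrP 0 (2 ^ k) x i (exprz_gt0 _ (ltr0n _ 2)).
by rewrite !mxE !add0r.
Qed.

Lemma exists_scale r s : 0 < s -> s <= r ->
  exists k : nat, s <= r / 2 ^+ k < 2 * s.
Proof.
move=> s0 sr; have r0 := lt_le_trans s0 sr.
have ex : exists k : nat, r / 2 ^+ k < 2 * s.
  exists (Num.truncn (r / s)).+1; rewrite ltr_pdivrMr ?exprn_gt0//.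
  have h1 := truncnS_gt (r / s); rewrite ltr_pdivrMr// in h1.
  apply: lt_le_trans h1 _; rewrite mulrAC ler_pM2r// -natrX -natrM ler_nat.
  by apply: leq_trans (leq_pmull _ _) => //; apply: ltnW; exact: ltn_expl.
case: (ex_minnP ex) => k hk hmin; exists k; rewrite hk andbT.
case: k hk hmin => [|k] hk hmin; first by rewrite expr0 divr1.
rewrite leNgt; apply/negP => h; have /hmin : r / 2 ^+ k < 2 * s.
  by move: h; rewrite exprS invfM mulrCA; lra.
by rewrite ltnn.
Qed.

Lemma exists_dyadic_scale s : 0 < s -> exists k : int, s <= (2 : R) ^ k < 2 * s.
Proof.
move=> s0; set N := (Num.truncn s).+1.
have sN : s <= 2 ^+ N.
  apply: (le_trans (ltW (truncnS_gt s))); rewrite -natrX ler_nat ltnW//.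
  exact: ltn_expl.
have [k hk] := exists_scale s0 sN.
by exists (N%:Z - k%:Z); rewrite expfzDr// -exprnN -exprnP.
Qed.

End grid.

Section content_cube_le.
Context {R : realType} {n : nat} (beta : R).
Hypothesis beta_gt0 : 0 < beta.
Local Notation H := (@dyadic_content R n beta).
Local Open Scope ereal_scope.

(** A cube of side [s] is covered by the dyadic cubes at its [2 ^ n] vertices, of side below [2 s]
    and hence of weight at most [2 ^ beta * s ^ beta] each. *)
Definition cube_const : R := (2 ^+ n * 2 `^ beta)%R.

Lemma cube_const_gt0 : (0 < cube_const)%R.
Proof. by rewrite mulr_gt0 ?exprn_gt0 ?powR_gt0. Qed.

Lemma content_cube_le (Q : 'rV[R]_n * R) : (0 < Q.2)%R ->
  H (cube Q) <= (cube_const * Q.2 `^ beta)%:E.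
Proof.
move=> s0; have [k /andP[sk ks]] := exists_dyadic_scale s0.
have k0 : (0 < 2 ^ k :> R)%R by rewrite exprz_gt0.
apply: le_trans (content_le_esum (beta := beta) beta_gt0
  (X := [set: {ffun 'I_n -> bool}]) (D := fun e => (k, adr 0 (2 ^ k) (vert Q.1 Q.2 e))) _) _.
  move=> x xQ.
  have [|e he] := @exists_vert _ _ 0 (2 ^ k) Q.1 Q.2 x k0 sk.
    by move=> i; have /andP[/ltW -> /ltW ->] := xQ i.
  exists e => //; rewrite he; exact: mem_dyadic_cube.
rewrite esum_finType; last by move=> *; rewrite lee_fin powR_ge0.
rewrite sumEFin lee_fin /side/= sumr_const card_ffun card_bool card_ord.
rewrite -[leLHS]mulr_natl natrX /cube_const -mulrA ler_pM2l ?exprn_gt0//.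
rewrite -powRM ?(ltW s0)//.
by apply: ge0_ler_powR; rewrite ?nnegrE ?(ltW beta_gt0) ?(ltW k0) ?mulr_ge0 ?(ltW s0) ?(ltW ks).
Qed.

End content_cube_le.

(** * Choquet integrals and Lebesgue integrals *)

Section integral_bounds.
Local Open Scope ereal_scope.

(* The integral of a nonnegative function is a supremum over the simple
   functions below it, hence monotone on nonmeasurable functions as well. *)
Lemma ge0_le_integral_nomeas d (T : measurableType d) (R : realType)
    (mu : {measure set T -> \bar R}) (D : set T) (f g : T -> \bar R) :
  (forall x, D x -> 0 <= f x) -> (forall x, D x -> f x <= g x) ->
  \int[mu]_(x in D) f x <= \int[mu]_(x in D) g x.
Proof.
move=> f0 fg.
rewrite !ge0_integralE//; last by move=> x Dx; exact: le_trans (f0 _ Dx) (fg _ Dx).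
apply: ereal_sup_le => _ [h hf <-]; exists h => // x.
by apply: le_trans (hf x) _; rewrite /patch; case: ifPn => // /set_mem/fg.
Qed.

Lemma nneseries_eq1 (R : realType) (f : nat -> \bar R) j :
  (forall i, i != j -> f i = 0) -> 0 <= f j -> \sum_(i <oo) f i = f j.
Proof.
move=> f0 fj; rewrite (@nneseriesD1 _ _ j)//; last first.
  by move=> i _; have [->|/f0 ->] := eqVneq i j.
by rewrite eseries0 ?adde0// => i _ /f0.
Qed.

Section step_function.
Context {R : realType} (e : R) (h : nat -> \bar R).
Hypothesis e_gt0 : (0 < e)%R.
Hypothesis h_ge0 : forall j, 0 <= h j.

Definition step_itv (j : nat) : set (measurableTypeR R) :=
  `[(j%:R * e)%R, (j.+1%:R * e)%R[%classic.

(** Written as a series of indicators so that it can be integrated term by term. *)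
Definition stepf (s : measurableTypeR R) : \bar R :=
  \sum_(j <oo) (h j * (\1_(step_itv j) s)%:E).

Lemma step_itv_inj i j s : step_itv i s -> step_itv j s -> i = j.
Proof.
rewrite /step_itv /= !in_itv/= => /andP[i1 i2] /andP[j1 j2].
have := le_lt_trans i1 j2; have := le_lt_trans j1 i2.
by rewrite !ltr_pM2r// !ltr_nat; lia.
Qed.

Lemma stepfE j s : step_itv j s -> stepf s = h j.
Proof.
move=> js; rewrite /stepf (@nneseries_eq1 _ _ j).
- by rewrite indicE mem_set// mule1.
- move=> i ij; rewrite indicE memNset ?mule0// => is_.
  by move: ij; rewrite (step_itv_inj is_ js) eqxx.
- by rewrite mule_ge0// lee_fin.
Qed.

Lemma exists_step_itv (s : R) : (0 <= s)%R -> exists j, step_itv j s.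
Proof.
move=> s0; exists (Num.truncn (s / e)).
have /andP[h1 h2] := truncn_itv (divr_ge0 s0 (ltW e_gt0)).
by rewrite /step_itv /= in_itv/= -ler_pdivlMr// h1/= -ltr_pdivrMr.
Qed.

Lemma integral_stepf :
  \int[@lebesgue_measure R]_(s in `[0%R, +oo[) stepf s = e%:E * \sum_(j <oo) h j.
Proof.
have mI j : measurable (step_itv j) by exact: measurable_itv.
rewrite integral_nneseries//=; last 2 first.
- move=> j; apply: emeasurable_funM; first exact: measurable_cst.
  by apply/measurable_EFinP; exact: measurable_indic.
- by move=> j s _; rewrite mule_ge0// lee_fin.
rewrite -nneseriesZl//; apply: eq_eseriesr => j _.
rewrite ge0_integralZl//; last first.
  by apply/measurable_EFinP; exact: measurable_indic.
rewrite integral_indic// setIidl; last first.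
  move=> s; rewrite /step_itv /= !in_itv/= andbT => /andP[+ _].
  by apply: le_trans; rewrite mulr_ge0// ltW.
rewrite muleC; congr (_ * _).
apply: etrans (lebesgue_measure_itv _) _.
rewrite /= lte_fin ltr_pM2r// ltr_nat ltnSn.
by rewrite -EFinB -mulrBl -natrB// subSnn mul1r.
Qed.

End step_function.

Section layers.
Context d (T : measurableType d) (R : realType) (mu : {measure set T -> \bar R}).
Context (e : R) (V : nat -> set T) (S : set T).
Hypotheses (e_ge0 : (0 <= e)%R) (mV : forall j, measurable (V j)) (mS : measurable S).

(** [e] times one plus the number of [V j] containing [x]. If each [V j] contains the set where
    [u > (j + 1) e], this dominates [u]; the additive [e] accounts for the last incomplete layer. *)
Definition layers (x : T) : \bar R := e%:E + \sum_(j <oo) (e%:E * (\1_(V j) x)%:E).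

Let g0 j x : 0 <= e%:E * (\1_(V j) x)%:E.
Proof. by rewrite mule_ge0// lee_fin. Qed.

Let mg j : measurable_fun setT (fun x => e%:E * (\1_(V j) x)%:E).
Proof.
apply: emeasurable_funM; first exact: measurable_cst.
by apply/measurable_EFinP; exact: measurable_indic.
Qed.

Lemma layers_ge0 x : 0 <= layers x.
Proof. by rewrite adde_ge0 ?lee_fin//; exact: nneseries_ge0. Qed.

Lemma measurable_layers : measurable_fun setT layers.
Proof.
apply: emeasurable_funD; first exact: measurable_cst.
by apply: ge0_emeasurable_sum.
Qed.

Lemma layers_ge m x : (forall j, (j < m)%N -> V j x) -> (m.+1%:R * e)%:E <= layers x.
Proof.
move=> hm; apply: (@le_trans _ _ (e%:E + \sum_(0 <= j < m) (e%:E * (\1_(V j) x)%:E))).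
  rewrite big_nat (eq_bigr (fun=> e%:E)); last first.
    by move=> j /= jm; rewrite indicE mem_set ?mule1//; exact: hm.
  rewrite -big_nat sumEFin lee_fin sumr_const_nat subn0.
  by rewrite -[(e *+ m)%R]mulr_natl -natr1 mulrDl mul1r addrC.
by rewrite leeD2l//; apply: nneseries_lim_ge.
Qed.

Lemma integral_layers :
  \int[mu]_(x in S) layers x = e%:E * mu S + \sum_(j <oo) (e%:E * mu (V j `&` S)).
Proof.
rewrite ge0_integralD//; last 2 first.
- by move=> x _; exact: nneseries_ge0.
- by apply: (measurable_funS measurableT) => //; exact: ge0_emeasurable_sum.
rewrite integral_cst// integral_nneseries//; last first.
  by move=> j; apply: (measurable_funS measurableT).
congr (_ + _); apply: eq_eseriesr => j _.
rewrite ge0_integralZl ?lee_fin//; first by rewrite integral_indic.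
by apply/measurable_EFinP; exact: measurable_indic.
Qed.

End layers.

Section choquet_bounds.
Context {R : realType} {n : nat} (beta : R).
Hypothesis beta_gt0 : (0 < beta)%R.
Hypothesis beta_le : (beta <= n%:R)%R.
Implicit Types (Q : 'rV[R]_n * R) (A B : set 'rV[R]_n) (u v : 'rV[R]_n -> \bar R).
Local Notation H := (@dyadic_content R n beta).

(** The content of a level set is nonincreasing in the level, so its value at the right end of each
    interval gives a lower sum; [choquet_le_series] takes the left end and gives an upper sum. *)
Lemma choquet_ge_series (e : R) A u : (0 < e)%R ->
  e%:E * \sum_(j <oo) H [set x | A x /\ (j.+1%:R * e)%:E < u x] <= choquet beta A u.
Proof.
move=> e0; rewrite -integral_stepf//; last by move=> j; exact: content_ge0.
apply: ge0_le_integral_nomeas => s; rewrite /= in_itv/= andbT => s0;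
  have [j js] := exists_step_itv e0 s0.
  by rewrite (stepfE e0 _ js)//; move=> *; exact: content_ge0.
rewrite (stepfE e0 _ js); last by move=> *; exact: content_ge0.
apply: le_content => x [Ax jx]; split => //; apply: le_lt_trans jx.
by move: js; rewrite /step_itv /= in_itv/= lee_fin => /andP[_ /ltW].
Qed.

Lemma choquet_le_series (e : R) A u : (0 < e)%R ->
  choquet beta A u <= e%:E * \sum_(j <oo) H [set x | A x /\ (j%:R * e)%:E < u x].
Proof.
move=> e0; rewrite -integral_stepf//; last by move=> j; exact: content_ge0.
apply: ge0_le_integral_nomeas => s; first by move=> _; exact: content_ge0.
rewrite /= in_itv/= andbT => s0; have [j js] := exists_step_itv e0 s0.
rewrite (stepfE e0 _ js); last by move=> *; exact: content_ge0.
apply: le_content => x [Ax jx]; split => //; apply: le_lt_trans jx.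
by move: js; rewrite /step_itv /= in_itv/= lee_fin => /andP[].
Qed.

Lemma choquet_ge0 A u : 0 <= choquet beta A u.
Proof. by apply: integral_ge0 => s _; exact: content_ge0. Qed.

Lemma le_choquet A B u v : A `<=` B -> (forall x, A x -> u x <= v x) ->
  choquet beta A u <= choquet beta B v.
Proof.
move=> AB uv; apply: ge0_le_integral_nomeas => s _; first exact: content_ge0.
apply: le_content => x [Ax ux]; split; first exact: AB.
exact: lt_le_trans (uv _ Ax).
Qed.

Lemma choquet_chebyshev (t : R) A u : (0 < t)%R ->
  t%:E * H [set x | A x /\ t%:E < u x] <= choquet beta A u.
Proof.
move=> t0; apply: le_trans (choquet_ge_series A u t0).
rewrite lee_pmul2l// (@nneseriesD1 _ _ 0%N)//; last by move=> *; exact: content_ge0.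
rewrite mul1r leeDl//; apply: nneseries_ge0 => *; exact: content_ge0.
Qed.

(* A measurable stand-in for [u]: the dyadic covers that nearly realise the
   contents of the level sets {u > (j + 1) e} turn the Choquet integral into a
   Lebesgue integral. *)
Lemma choquet_majorant Q (u : 'rV[R]_n -> R) (X : R) : (0 < Q.2)%R -> (0 < X)%R ->
  choquet beta (cube Q) (EFin \o u) <= X%:E ->
  exists G : caratheodory_type (@borel_lebesgue R n)^*%mu -> \bar R,
    [/\ measurable_fun setT G, (forall x, 0 <= G x),
        (forall x, cube Q x -> (u x)%:E <= G x) &
        \int[lebesgue_rV n]_(x in cube Q) G x <=
          (3 * (Q.2 `^ (n%:R - beta) * X))%:E].
Proof.
move=> s0 X0 uX; set s := Q.2 in s0 *.
(* With this mesh the additive layer, the level sets and the slack of the covers each contribute at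
   most [s ^ (n - beta) * X], whence the factor 3. *)
pose e := (X / s `^ beta)%R.
have sb0 : (0 < s `^ beta)%R by rewrite powR_gt0.
have e0 : (0 < e)%R by rewrite divr_gt0.
pose h j := H [set x | cube Q x /\ (j.+1%:R * e)%:E < (u x)%:E].
have h0 j : 0 <= h j by exact: content_ge0.
have hX : e%:E * \sum_(j <oo) h j <= X%:E.
  exact: le_trans (choquet_ge_series _ _ e0) uX.
have hfin j : h j \is a fin_num.
  rewrite ge0_fin_numE// ltey; apply/eqP => hj; move: hX.
  rewrite (_ : \sum_(j <oo) h j = +oo); last first.
    by apply: eseries_pinfty hj => // i _; rewrite gt_eqF// (lt_le_trans _ (h0 i)).
  by rewrite gt0_muley ?lte_fin.
have hD j : exists D : nat -> int * 'rV[int]_n,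
    [set x | cube Q x /\ (j.+1%:R * e)%:E < (u x)%:E] `<=` \bigcup_i dyadic_cube (D i) /\
    \sum_(i <oo) (side (D i) `^ beta)%:E <= h j + (s `^ beta / (2 ^ j.+1)%:R)%:E.
  have e2 : (0 < s `^ beta / (2 ^ j.+1)%:R)%R by rewrite divr_gt0.
  have [_ [D hD <-] hlt] := lb_ereal_inf_adherent e2 (hfin j).
  by exists D; split => //; exact: ltW.
have {hD}[D hD] := choice hD.
pose V j : set 'rV[R]_n := \bigcup_i dyadic_cube (D j i).
have mV j : measurable (V j) by apply: bigcup_measurable => i _; exact: measurable_dyadic_cube.
have mQ : measurable (cube Q) by exact: measurable_cube.
have mV' j := measurable_lebesgue_rV (mV j).
have mQ' := measurable_lebesgue_rV mQ.
exists (layers e V); split.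
- by apply: measurable_layers => //; exact: ltW.
- by move=> x; apply: layers_ge0; exact: ltW.
- move=> x Qx.
  have ex : exists m, (u x <= m.+1%:R * e)%R.
    exists (Num.truncn (u x / e)); rewrite -ler_pdivrMr// ltW//.
    exact: truncnS_gt.
  case: (ex_minnP ex) => m um mmin.
  apply: (@le_trans _ _ (m.+1%:R * e)%:E); first by rewrite lee_fin.
  apply: layers_ge; first exact: ltW.
  move=> j jm; apply: (hD j).1; split => //; rewrite lte_fin ltNge.
  by apply/negP => /mmin; rewrite leqNgt jm.
rewrite integral_layers ?(ltW e0)//.
rewrite [X in e%:E * X + _](_ : _ = (s ^+ n)%:E); last first.
  exact: etrans (lebesgue_rVE mQ) (lebesgue_cube s0).
have sE : (s ^+ n = s `^ (n%:R - beta) * s `^ beta)%R.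
  rewrite -powRD; last by rewrite (gt_eqF s0) implybT.
  by rewrite subrK powR_mulrn// ltW.
set w := (s `^ (n%:R - beta))%R; have w0 : (0 <= w)%R by rewrite powR_ge0.
have eq1 : (e * s ^+ n = w * X)%R.
  by rewrite sE /e -/w; field; rewrite gt_eqF.
apply: (@le_trans _ _ ((w * X)%:E + \sum_(j <oo)
    ((e * w)%:E * (h j + (s `^ beta / (2 ^ j.+1)%:R)%:E)))).
  rewrite -EFinM eq1 leeD2l//; apply: lee_nneseries.
    by move=> j _ _; rewrite mule_ge0// lee_fin ltW.
  move=> j _; rewrite (EFinM e w) -muleA lee_pmul2l ?lte_fin// setIC.
  have hV := lebesgue_cover_le beta_gt0 beta_le (D j) s0.
  have mI : measurable (cube Q `&` V j) by apply: measurableI.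
  apply: le_trans (le_trans _ hV) _; first by rewrite -lebesgue_rVE.
  by rewrite lee_wpmul2l ?lee_fin// (hD j).2.
rewrite nneseriesZl; last first.
  by move=> j _; rewrite adde_ge0// lee_fin divr_ge0 ?ler0n ?(ltW sb0).
apply: (@le_trans _ _ ((w * X)%:E + ((e * w)%:E * (\sum_(j <oo) h j + (s `^ beta)%:E)))).
  have ew0 : (0 <= e * w)%R by exact: mulr_ge0 (ltW e0) w0.
  rewrite leeD2l// lee_wpmul2l ?lee_fin//.
  exact: (@epsilon_trick _ h (s `^ beta)%R xpredT h0 (ltW sb0)).
rewrite (_ : (e * w)%:E = w%:E * e%:E); last by rewrite -EFinM mulrC.
rewrite -muleA ge0_muleDr//; last 2 first.
- exact: nneseries_ge0.
- by rewrite lee_fin ltW.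
apply: (@le_trans _ _ ((w * X)%:E + w%:E * (X%:E + (e * s `^ beta)%:E))).
  by rewrite leeD2l// lee_wpmul2l ?lee_fin// EFinM leeD2r.
have -> : (e * s `^ beta = X)%R by rewrite /e divfK// gt_eqF.
by rewrite -(EFinD X) -(EFinM w) -EFinD lee_fin; lra.
Qed.

End choquet_bounds.
End integral_bounds.

Section comparison.
Local Open Scope ereal_scope.
Context d (T : measurableType d) (R : realType) (mu : {measure set T -> \bar R}).
Context (S : set T) (u G : T -> \bar R) (c : R).
Hypotheses (mS : measurable S) (c_ge0 : (0 <= c)%R) (u_ge0 : forall x, S x -> 0 <= u x).
Hypotheses (mG : measurable_fun setT G) (G_ge0 : forall x, 0 <= G x).

Let mGS : measurable_fun S G.
Proof. by apply: (measurable_funS measurableT). Qed.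

Lemma integral_le_cstD : (forall x, S x -> u x <= c%:E + G x) ->
  \int[mu]_(x in S) u x <= c%:E * mu S + \int[mu]_(x in S) G x.
Proof.
move=> uG; rewrite -integral_cst// -ge0_integralD//.
exact: ge0_le_integral_nomeas.
Qed.

(** No measurability of [u] is assumed, so additivity is applied to [G] and to the positive part [w]
    of [c - G], a measurable minorant of [u]. *)
Lemma integral_ge_cstB : (forall x, S x -> c%:E <= u x + G x) ->
  c%:E * mu S <= \int[mu]_(x in S) u x + \int[mu]_(x in S) G x.
Proof.
move=> cuG; pose w x := maxe (c%:E - G x) 0.
have w0 x : 0 <= w x by rewrite /w le_max lexx orbT.
have mw : measurable_fun S w.
  apply: measurable_maxe => //; apply: emeasurable_funB => //.
rewrite -integral_cst//.
apply: (@le_trans _ _ (\int[mu]_(x in S) (w x + G x))).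
  apply: ge0_le_integral_nomeas => x Sx; first by rewrite lee_fin.
  have := G_ge0 x; rewrite /w; case: (G x) => [g|_|//].
    rewrite lee_fin => g0; rewrite -EFinB -EFin_max -EFinD lee_fin.
    by rewrite -lerBlDr le_max lexx.
  by rewrite /= max_r ?leNye// add0e leey.
rewrite ge0_integralD// leeD2r//; apply: ge0_le_integral_nomeas => // x Sx.
rewrite /w ge_max u_ge0// andbT; have := cuG x Sx; have := G_ge0 x; have := u_ge0 Sx.
case: (u x) (G x) => [v| |//] [g| |] //= _ _; rewrite ?leey ?leNye//.
by rewrite -EFinD -EFinB !lee_fin lerBlDr.
Qed.

End comparison.

(** * Lebesgue averages and centres of cubes *)

Section averages.
Context {R : realType} {n : nat} (beta : R).
Hypothesis beta_gt0 : 0 < beta.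
Hypothesis beta_le : beta <= n%:R.
Context (Q : set 'rV[R]_n) (f : 'rV[R]_n -> R).
Implicit Types (P S : 'rV[R]_n * R).
Local Notation H := (@dyadic_content R n beta).
Local Notation F := (patch (fun=> 0) Q f).
Local Open Scope ereal_scope.

Definition avg (g : 'rV[R]_n -> R) P : \bar R :=
  (P.2 ^- n)%:E * \int[lebesgue_rV n]_(y in cube P) `|g y|%:E.

Lemma maximal_ge g P x : (0 < P.2)%R -> cube P x -> avg g P <= maximal g x.
Proof. by move=> P0 Px; apply: ereal_sup_ubound; exists P. Qed.

Lemma maximal_le g x B : (forall P, (0 < P.2)%R -> cube P x -> avg g P <= B) ->
  maximal g x <= B.
Proof. by move=> h; apply: ge_ereal_sup => _ [P [P0 Px] <-]; exact: h. Qed.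

(** [F] vanishes off [Q], so the smaller cube [P] keeps all the mass that [S] carries and divides it
    by a smaller volume. *)
Lemma avg_patch_le S P : (0 < P.2)%R -> (P.2 <= S.2)%R ->
  cube S `&` Q `<=` cube P -> avg F S <= avg F P.
Proof.
move=> P0 PS SQP; apply: lee_pmul.
- by rewrite lee_fin invr_ge0 exprn_ge0 ?(le_trans (ltW P0) PS).
- by apply: integral_ge0 => x _; rewrite lee_fin.
- rewrite lee_fin lef_pV2 ?posrE ?exprn_gt0 ?(lt_le_trans P0 PS)//.
  by rewrite lerXn2r ?nnegrE ?(ltW P0) ?(le_trans (ltW P0) PS).
have F0 x : ~ Q x -> F x = 0%R by move=> Qx; rewrite patchE memNset.
move: F F0 => F F0; rewrite integral_mkcond [leRHS]integral_mkcond.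
apply: ge0_le_integral_nomeas => x _.
  by rewrite patchE; case: ifP => // _; rewrite lee_fin.
rewrite !patchE; case: ifPn => [/set_mem Sx|_]; last first.
  by case: ifPn => // _; rewrite lee_fin.
have [Qx|/F0 ->] := pselect (Q x); first by rewrite mem_set//; exact: SQP.
by rewrite normr0; case: ifP.
Qed.

Lemma lebesgue_rV_cube P : (0 < P.2)%R ->
  lebesgue_rV n (cube P) = (P.2 ^+ n)%:E :> \bar R.
Proof. by move=> P0; rewrite lebesgue_rVE ?lebesgue_cube//; exact: measurable_cube. Qed.

Lemma avg_le_choquet P (X : R) : (0 < X)%R -> subcubes Q P ->
  choquet beta Q (fun x => `|f x|%:E) <= X%:E ->
  avg F P <= (3 * (P.2 `^ (- beta) * X))%:E.
Proof.
move=> X0 [P0 PQ] fX.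
have [|G [mG G0 fG iG]] := @choquet_majorant R n beta beta_gt0 beta_le P (fun x => `|f x|%R) X P0 X0.
  by apply: le_trans fX; exact: (le_choquet beta PQ (fun x _ => lexx _)).
rewrite /avg (_ : 3 * _ = P.2 ^- n * (3 * (P.2 `^ (n%:R - beta) * X)))%R; last first.
  rewrite powRD; last by rewrite (gt_eqF P0) implybT.
  by rewrite powR_mulrn ?(ltW P0)//; field; rewrite expf_neq0 ?gt_eqF.
rewrite EFinM lee_wpmul2l ?lee_fin ?invr_ge0 ?exprn_ge0 ?(ltW P0)//.
apply: le_trans iG; apply: ge0_le_integral_nomeas => x Px; first by rewrite lee_fin.
by rewrite patchE mem_set; [exact: fG|exact: PQ].
Qed.

Section oscillation.
Context (K : R) (c : 'rV[R]_n * R -> R).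
Hypothesis K_gt0 : (0 < K)%R.
Hypothesis hc : forall P, subcubes Q P ->
  choquet beta (cube P) (fun x => `|f x - c P|%:E) <= (K * P.2 `^ beta)%:E.

Lemma oscillation_majorant P : subcubes Q P ->
  exists G : caratheodory_type (@borel_lebesgue R n)^*%mu -> \bar R,
    [/\ measurable_fun setT G, (forall x, 0 <= G x),
        (forall x, cube P x -> `|f x - c P|%:E <= G x) &
        \int[lebesgue_rV n]_(x in cube P) G x <= (3 * K * P.2 ^+ n)%:E].
Proof.
move=> hP; have P0 := hP.1.
have X0 : (0 < K * P.2 `^ beta)%R by rewrite mulr_gt0 ?powR_gt0.
have [G [mG G0 fG iG]] := choquet_majorant beta_gt0 beta_le P0 X0 (hc hP).
exists G; split => //; apply: le_trans iG _; rewrite lee_fin.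
rewrite [X in (3 * X)%R]mulrCA -powRD; last by rewrite (gt_eqF P0) implybT.
by rewrite subrK powR_mulrn ?(ltW P0)// mulrA.
Qed.

Lemma avg_le P : subcubes Q P -> avg F P <= (`|c P| + 3 * K)%:E.
Proof.
move=> hP; have [P0 PQ] := hP; have [G [mG G0 fG iG]] := oscillation_majorant hP.
have mP := measurable_lebesgue_rV (measurable_cube P).
have := @integral_le_cstD _ _ _ (lebesgue_rV n) (cube P)
  (fun x => `|F x|%:E) G `|c P| mP (normr_ge0 _) _ mG G0.
move=> /(_ _ _)/le_trans h.
have {}h : \int[lebesgue_rV n]_(x in cube P) `|F x|%:E <=
    ((`|c P| + 3 * K) * P.2 ^+ n)%:E.
  apply: h => [x _|x Px|]; first by rewrite lee_fin.
    rewrite patchE mem_set; last exact: PQ.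
    apply: (@le_trans _ _ (`|c P| + `|f x - c P|)%:E).
      by rewrite lee_fin -[X in (`|X| <= _)%R](subrKC (c P)) ler_normD.
    by rewrite EFinD leeD2l// fG.
  rewrite mulrDl EFinD leeD//.
  by rewrite [X in _ * X](_ : _ = (P.2 ^+ n)%:E) -?EFinM//; exact: lebesgue_rV_cube.
rewrite /avg (_ : (`|c P| + 3 * K) = P.2 ^- n * ((`|c P| + 3 * K) * P.2 ^+ n))%R.
  by rewrite EFinM lee_wpmul2l ?lee_fin ?invr_ge0 ?exprn_ge0 ?(ltW P0).
by rewrite [RHS]mulrC mulfK// gt_eqF// exprn_gt0.
Qed.

Lemma avg_ge P : subcubes Q P -> (`|c P| - 3 * K)%:E <= avg F P.
Proof.
move=> hP; have [P0 PQ] := hP; have [G [mG G0 fG iG]] := oscillation_majorant hP.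
have mP := measurable_lebesgue_rV (measurable_cube P).
have := @integral_ge_cstB _ _ _ (lebesgue_rV n) (cube P)
  (fun x => `|F x|%:E) G `|c P| mP (normr_ge0 _) _ mG G0.
move=> /(_ _ _) h.
have {}h : ((`|c P| - 3 * K) * P.2 ^+ n)%:E <=
    \int[lebesgue_rV n]_(x in cube P) `|F x|%:E.
  rewrite mulrBl EFinB leeBlDr//.
  apply: (@le_trans _ _ (\int[lebesgue_rV n]_(x in cube P) `|F x|%:E +
       \int[lebesgue_rV n]_(x in cube P) G x)); last by rewrite leeD2l.
  apply: le_trans (h _ _) => [|x _|x Px]; last 2 first.
  - by rewrite lee_fin.
  - rewrite patchE mem_set; last exact: PQ.
    apply: (@le_trans _ _ (`|f x| + `|f x - c P|)%:E).
      by rewrite lee_fin -[X in (`|X| <= _)%R](subKr (f x)) ler_normB.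
    by rewrite EFinD leeD2l// fG.
  by rewrite [X in _ <= _ * X](_ : _ = (P.2 ^+ n)%:E) -?EFinM//; exact: lebesgue_rV_cube.
rewrite /avg (_ : (`|c P| - 3 * K) = P.2 ^- n * ((`|c P| - 3 * K) * P.2 ^+ n))%R.
  by rewrite EFinM lee_wpmul2l ?lee_fin ?invr_ge0 ?exprn_ge0 ?(ltW P0).
by rewrite [RHS]mulrC mulfK// gt_eqF// exprn_gt0.
Qed.

(** By Chebyshev the set where [|f - c P| > 3 K] has content at most a third of [P.2 ^ beta]. With
    the half taken by [A] this falls short of the content of [P], so some point is left over. *)
Lemma exists_close_value P (A : set 'rV[R]_n) : subcubes Q P ->
  H (A `&` cube P) <= (P.2 `^ beta / 2)%:E ->
  exists x, [/\ cube P x, ~ A x & (`|f x - c P| <= 3 * K)%R].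
Proof.
move=> hP hA; have P0 := hP.1.
have pb0 : (0 < P.2 `^ beta)%R by rewrite powR_gt0.
apply/not_existsP => hx.
pose B := [set x | cube P x /\ (3 * K)%:E < `|f x - c P|%:E].
have hB : H B <= (P.2 `^ beta / 3)%:E.
  have K3 : (0 < 3 * K)%R by rewrite mulr_gt0.
  have := le_trans (choquet_chebyshev beta (cube P) (fun x => `|f x - c P|%:E) K3) (hc hP).
  rewrite -/B -lee_pdivlMl// -EFinM => /le_trans; apply; rewrite lee_fin.
  by rewrite le_eqVlt; apply/orP; left; apply/eqP; field; rewrite gt_eqF.
have : H (cube P) <= (P.2 `^ beta / 2)%:E + (P.2 `^ beta / 3)%:E.
  apply: le_trans (leeD hA hB); apply: le_trans (contentU beta_gt0 _ _).
  apply: le_content => x Px; have [Ax|Ax] := pselect (A x); [by left|right].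
  by split => //; rewrite lte_fin ltNge; apply/negP => h; apply: (hx x).
move/(le_trans (content_cube_ge beta_gt0 beta_le P0)).
by rewrite -EFinD lee_fin; lra.
Qed.

Lemma far_content P (L : R) : (0 < L)%R -> subcubes Q P ->
  H [set x | cube P x /\ (L < `|f x - c P|)%R] <= (K * P.2 `^ beta / L)%:E.
Proof.
move=> L0 hP.
have := le_trans (choquet_chebyshev beta (cube P) (fun x => `|f x - c P|%:E) L0) (hc hP).
by rewrite -lee_pdivlMl// -EFinM mulrC.
Qed.

(** Some point of [P] has its value of [f] within [3 K] of [c P] and within [L] of [c P']. *)
Lemma close_of_sparse P P' (L : R) : subcubes Q P -> subcubes Q P' ->
  cube P `<=` cube P' ->
  H ([set x | cube P' x /\ (L < `|f x - c P'|)%R] `&` cube P) <= (P.2 `^ beta / 2)%:E ->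
  (`|c P - c P'| <= L + 3 * K)%R.
Proof.
move=> hP hP' PP' /(exists_close_value hP)[x [Px nAx fx]].
have : (`|f x - c P'| <= L)%R.
  by rewrite leNgt; apply/negP => h; apply: nAx; split => //; exact: PP'.
move: fx; rewrite !ler_norml => /andP[? ?] /andP[? ?]; apply/andP; split; lra.
Qed.

(** At level [2 l ^ beta K], Chebyshev in the larger cube bounds the exceptional set by half of
    [P.2 ^ beta], so it is sparse in [P]. *)
Lemma close_of_ratio P P' (l : R) : (0 < l)%R -> subcubes Q P -> subcubes Q P' ->
  cube P `<=` cube P' -> (P'.2 <= l * P.2)%R ->
  (`|c P - c P'| <= 2 * l `^ beta * K + 3 * K)%R.
Proof.
move=> l0 hP hP' PP' ll; have P0 := hP.1; have P0' := hP'.1.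
have lb0 : (0 < l `^ beta)%R by rewrite powR_gt0.
have L0 : (0 < 2 * l `^ beta * K)%R by rewrite !mulr_gt0.
apply: close_of_sparse => //.
apply: le_trans (le_content beta (@subIsetl _ _ _)) _.
apply: le_trans (far_content L0 hP') _; rewrite lee_fin.
have h : (P'.2 `^ beta <= l `^ beta * P.2 `^ beta)%R.
  rewrite -powRM ?(ltW l0) ?(ltW P0)//.
  by apply: ge0_ler_powR; rewrite ?nnegrE ?(ltW beta_gt0) ?(ltW P0') ?mulr_ge0 ?(ltW l0) ?(ltW P0).
rewrite ler_pdivrMr//; apply: (@le_trans _ _ (K * (l `^ beta * P.2 `^ beta))%R).
  by rewrite ler_pM2l.
by rewrite le_eqVlt; apply/orP; left; apply/eqP; field.
Qed.

End oscillation.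
End averages.

(** * Stopping cells *)

Section clamp.
Context {R : realType} {n : nat}.
Implicit Types (P S A : 'rV[R]_n * R).

Lemma cube_clamp A S : 0 < A.2 -> 0 < S.2 ->
  exists P, [/\ P.2 = Num.min S.2 A.2, cube P `<=` cube A
              & cube S `&` cube A `<=` cube P].
Proof.
move=> A0 S0; pose m := Num.min S.2 A.2.
have mS : m <= S.2 by rewrite ge_min lexx.
have mA : m <= A.2 by rewrite ge_min lexx orbT.
(* The side is cut down to [m], then each coordinate of the corner is pushed into the range that
   keeps the cube inside [A]. *)
exists (\row_i Num.max (A.1 ord0 i) (Num.min (S.1 ord0 i) (A.1 ord0 i + A.2 - m)), m).
split=> // x h i; move: h.
  move=> /(_ i); rewrite /= mxE => /andP[]; rewrite gt_max => /andP[h1 h2] h3.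
  rewrite h1/=; apply: lt_le_trans h3 _; rewrite -lerBrDr ge_max ge_min.
  by rewrite lexx orbT andbT; lra.
move=> [/(_ i)/andP[s1 s2] /(_ i)/andP[a1 a2]]; rewrite /= mxE gt_max a1/= gt_min s1/=.
rewrite -ltrBlDr lt_max lt_min; have [h|h] := leP S.2 A.2.
  have mE : m = S.2 by rewrite /m; apply/min_idPl.
  by rewrite !mE; apply/orP; right; apply/andP; split; lra.
have mE : m = A.2 by rewrite /m; apply/min_idPr/ltW.
by rewrite mE; apply/orP; left; lra.
Qed.

Lemma side_le_of_sub A S : (0 < n)%N -> 0 < S.2 -> 0 < A.2 ->
  cube S `<=` cube A -> S.2 <= A.2.
Proof.
move=> n0 S0 A0 SA; rewrite leNgt; apply/negP => AS.
(* Two points of [S] at distance [e] from opposite faces are [A.2] apart in the first coordinate,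
   too far for an open interval of length [A.2]. *)
pose e := (S.2 - A.2) / 2.
have h (t : R) : 0 < t < S.2 -> A.1 ord0 (Ordinal n0) < S.1 ord0 (Ordinal n0) + t < A.1 ord0 (Ordinal n0) + A.2.
  move=> /andP[t0 tS]; have := SA (\row_i (S.1 ord0 i + t)) _ (Ordinal n0).
  by rewrite mxE; apply => i; rewrite mxE; apply/andP; split; lra.
have /h/andP[h1 h2] : 0 < e < S.2 by rewrite /e; apply/andP; split; lra.
have /h/andP[h3 h4] : 0 < S.2 - e < S.2 by rewrite /e; apply/andP; split; lra.
by move: h1 h2 h3 h4; rewrite /e; lra.
Qed.

End clamp.

Section esum_lemmas.
Context {R : realType}.
Local Open Scope ereal_scope.

Lemma esumZl_le (T : choiceType) (A : set T) (k : R) (a : T -> \bar R) :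
  (0 <= k)%R -> (forall t, 0 <= a t) ->
  \esum_(t in A) (k%:E * a t) <= k%:E * \esum_(t in A) a t.
Proof.
move=> k0 a0; apply: ge_ereal_sup => _ [X XA <-].
rewrite -ge0_mule_fsumr//; apply: lee_wpmul2l; first by rewrite lee_fin.
by apply: ereal_sup_ubound; exists X.
Qed.

Lemma esum_disjoint_le (T K : choiceType) (A : set K) (B : K -> set T) (a : T -> \bar R) :
  (forall t, 0 <= a t) ->
  (forall i j t, A i -> A j -> B i t -> B j t -> i = j) ->
  \esum_(i in A) \esum_(t in B i) a t <= \esum_(t in [set: T]) a t.
Proof.
move=> a0 disj; rewrite (@esum_esum _ _ _ A B (fun=> a))//.
rewrite -(esum_image _ snd a); first exact: sub_esum.
move=> [i t] [j t'] /set_mem[/= Ai Bt] /set_mem[/= Aj Bt'] /= tt'.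
by rewrite -tt' in Bt' *; rewrite (disj i j t).
Qed.

End esum_lemmas.

Section stopping.
Context {R : realType} {n : nat} (beta : R).
Hypothesis n_gt0 : (0 < n)%N.
Hypothesis beta_gt0 : 0 < beta.
Local Notation H := (@dyadic_content R n beta).
Local Notation C0 := (@cube_const R n beta).

(* Threshold for stopping: a cube of side s meets at most 2^n cells of side
   r < 2 s, so if each of them carries a weight below [sparse_const * r ^ beta],
   the cube carries a content of at most [s ^ beta / 2]. *)
Definition sparse_const : R := (2 * C0)^-1.
Local Notation eps := sparse_const.
(* So small that a stopped cell has side at most [l / 4], and that the fourfold
   enlargements of the stopped cells have total weight at most [l ^ beta / 2]. *)
Definition cover_const : R := eps / (2 * C0 * 4 `^ beta).
Local Notation delta := cover_const.

Lemma powR_ge1 (b : R) : 1 <= b -> 1 <= b `^ beta.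
Proof.
move=> b1; have {1}-> : 1 = 1 `^ beta :> R by rewrite powR1.
by apply: ge0_ler_powR; rewrite ?nnegrE ?(ltW beta_gt0) ?ler01 ?(le_trans ler01 b1).
Qed.

Lemma cube_const_ge : [/\ 1 <= C0, 2 ^+ n <= C0 & 2 `^ beta <= C0].
Proof.
have h1 : 1 <= 2 ^+ n :> R by rewrite exprn_ege1// ler1n.
have h2 : 1 <= 2 `^ beta :> R by rewrite powR_ge1// ler1n.
split; rewrite /cube_const.
- by rewrite -[leLHS]mulr1 ler_pM.
- by rewrite -[leLHS]mulr1 ler_pM ?exprn_ge0.
- by rewrite -[leLHS]mul1r ler_pM ?powR_ge0.
Qed.

Lemma sparse_const_gt0 : 0 < eps.
Proof. by rewrite invr_gt0 mulr_gt0// cube_const_gt0. Qed.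

Lemma cover_const_gt0 : 0 < delta.
Proof. by rewrite divr_gt0 ?sparse_const_gt0// !mulr_gt0 ?cube_const_gt0 ?powR_gt0. Qed.

Context (a : 'rV[R]_n) (l : R) (D : nat -> int * 'rV[int]_n).
Hypothesis l_gt0 : 0 < l.
Hypothesis sum_D : (\sum_(i <oo) (side (D i) `^ beta)%:E < (delta * l `^ beta)%:E)%E.
Local Notation A := (\bigcup_i dyadic_cube (D i) : set 'rV[R]_n).

Let r (k : nat) : R := l / 2 ^+ k.
Let r_gt0 k : 0 < r k. Proof. by rewrite divr_gt0 ?exprn_gt0. Qed.

Let rB k m : r k = (2 ^ m)%:R * r (k + m)%N.
Proof.
rewrite /r exprD invfM natrX mulrCA [X in _ = _ * X]mulrCA mulfV ?mulr1//.
Qed.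

Let le_r k k' : (k <= k')%N -> r k' <= r k.
Proof.
move=> kk; rewrite -(subnKC kk) (rB k (k' - k)) ler_peMl ?(ltW (r_gt0 _))//.
by rewrite ler1n expn_gt0.
Qed.

Let lt_r k k' : r k' < r k -> (k < k')%N.
Proof. by rewrite ltNge ltnNge; apply: contra; exact: le_r. Qed.

Let ad k x := adr a (r k) x.

Let ad_nest k k' x y : (k <= k')%N -> ad k' x = ad k' y -> ad k x = ad k y.
Proof.
move=> kk; rewrite /ad (rB k (k' - k)) (subnKC kk).
by apply: adr_nest; rewrite expn_gt0.
Qed.

Let corner (E : int * 'rV[int]_n) : 'rV[R]_n := \row_i (side E * (E.2 ord0 i)%:~R).
(* A cell that meets [D i] and is at least as long contains one of the 2^n
   vertices of [D i]; the weight of [D i] is therefore attached to its vertices. *)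
Let J : countType := (nat * {ffun 'I_n -> bool})%type.
Let v (j : J) : 'rV[R]_n := vert (corner (D j.1)) (side (D j.1)) j.2.
Let s (j : J) : R := side (D j.1).
Let cov k z : set J := [set j | s j <= r k /\ ad k (v j) = z].
Let mass k z : \bar R := \esum_(j in cov k z) (s j `^ beta)%:E.
Let bad k z : Prop := ((eps * r k `^ beta)%:E <= mass k z)%E.

Let w_ge0 j : (0 <= (s j `^ beta)%:E)%E. Proof. by rewrite lee_fin powR_ge0. Qed.

Let total_le : (\esum_(j in [set: J]) (s j `^ beta)%:E <=
  (2 ^+ n * (delta * l `^ beta))%:E)%E.
Proof.
rewrite (_ : [set: J] = [set: nat] `*`` (fun=> [set: {ffun 'I_n -> bool}])); last first.
  by apply/seteqP; split.
rewrite -(@esum_esum _ _ _ setT (fun=> setT) (fun i _ => (side (D i) `^ beta)%:E)); last first.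
  by move=> *; rewrite lee_fin powR_ge0.
rewrite (eq_esum (b := fun i => ((2 ^+ n)%:E * (side (D i) `^ beta)%:E)%E)); last first.
  move=> i _; rewrite esum_finType; last by move=> _; rewrite lee_fin powR_ge0.
  rewrite sumEFin sumr_const card_ffun card_bool card_ord.
  by rewrite -[X in X%:E]mulr_natl natrX EFinM.
rewrite -nneseries_esumT; last first.
  by move=> i; rewrite -EFinM lee_fin mulr_ge0 ?exprn_ge0 ?powR_ge0.
rewrite nneseriesZl; last by move=> *; rewrite lee_fin powR_ge0.
by rewrite EFinM lee_pmul2l ?lte_fin ?exprn_gt0// ltW.
Qed.

Let side_lt i : side (D i) < l.
Proof.
have : ((side (D i) `^ beta)%:E < (delta * l `^ beta)%:E)%E.
  apply: le_lt_trans sum_D; rewrite (@nneseriesD1 _ _ i)//.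
    by rewrite leeDl//; apply: nneseries_ge0 => *; rewrite lee_fin powR_ge0.
  by move=> *; rewrite lee_fin powR_ge0.
rewrite lte_fin => h; rewrite ltNge; apply/negP => li.
have : l `^ beta <= side (D i) `^ beta.
  by apply: ge0_ler_powR; rewrite ?nnegrE ?(ltW beta_gt0) ?(ltW l_gt0) ?(ltW (side_gt0 _)).
have [c1 _ _] := cube_const_ge.
have p4 : 1 <= 4 `^ beta :> R by rewrite powR_ge1// ler1n.
have d1 : delta <= 1.
  rewrite /cover_const /sparse_const -invfM invf_le1; last first.
    by rewrite !mulr_gt0 ?cube_const_gt0 ?powR_gt0.
  have q1 : 1 <= 2 * C0 by lra.
  by rewrite -[leLHS]mulr1 ler_pM// -[leLHS]mulr1 ler_pM.
have lb : 0 < l `^ beta by rewrite powR_gt0.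
have := ler_wpM2r (ltW lb) d1; lra.
Qed.

(** Even the total weight is below the threshold of a cell of side [l / 2]. Hence a stopped cell has
    a parent, and its fourfold enlargement is no longer than [l]. *)
Let bad_ge2 k z : bad k z -> (2 <= k)%N.
Proof.
move=> hb; rewrite ltnNge; apply/negP => k1.
have h1 : (mass k z <= (2 ^+ n * (delta * l `^ beta))%:E)%E.
  by apply: le_trans total_le; apply: sub_esum.
have := le_trans hb h1; rewrite lee_fin; apply/negP; rewrite -ltNge.
have y0 : 0 < (l / 2) `^ beta by rewrite powR_gt0 ?divr_gt0.
have yr : (l / 2) `^ beta <= r k `^ beta.
  apply: ge0_ler_powR; rewrite ?nnegrE ?(ltW beta_gt0) ?(ltW (r_gt0 _)) ?divr_ge0 ?(ltW l_gt0)//.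
  by apply: le_trans (le_r k1); rewrite /r expr1.
have lE : l `^ beta = (l / 2) `^ beta * 2 `^ beta.
  by rewrite -powRM ?divr_ge0 ?(ltW l_gt0)// divfK.
have e0 := sparse_const_gt0; have C00 := @cube_const_gt0 R n beta.
have p4 : 1 <= 4 `^ beta :> R by rewrite powR_ge1// ler1n.
have p2 : 0 < 2 `^ beta :> R by rewrite powR_gt0.
apply: lt_le_trans (_ : eps * (l / 2) `^ beta <= _); last by rewrite ler_pM2l.
rewrite lE (_ : _ * _ = (2 * 4 `^ beta)^-1 * (eps * (l / 2) `^ beta)).
  by rewrite gtr_pMl ?mulr_gt0// invf_lt1 ?mulr_gt0//; lra.
rewrite /cover_const /cube_const; field.
by rewrite !gt_eqF ?exprn_gt0 ?powR_gt0.
Qed.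

Let exists_cov i y k : dyadic_cube (D i) y -> side (D i) <= r k ->
  exists2 j, cov k (ad k y) j & j.1 = i.
Proof.
move=> iy sk; have [|e he] := @exists_vert _ _ a (r k) (corner (D i)) (side (D i)) y (r_gt0 k) sk.
  by move=> m; have /andP[h1 h2] := iy m; rewrite mxE h1/= -[X in _ + X]mulr1 -mulrDr ltW.
by exists (i, e).
Qed.

(** At the scale just above [side (D i)], the weight of [D i] alone reaches the threshold. *)
Let exists_bad i y : dyadic_cube (D i) y -> exists2 k, side (D i) <= r k & bad k (ad k y).
Proof.
move=> iy; have [k /andP[k1 k2]] := exists_scale (side_gt0 (D i)) (ltW (side_lt i)).
exists k => //; have [j jk ji] := exists_cov iy k1.
apply: (@le_trans _ _ (s j `^ beta)%:E).
  rewrite lee_fin /s ji; have [c1 c2 c3] := cube_const_ge.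
  apply: (@le_trans _ _ (eps * (2 * side (D i)) `^ beta)).
    rewrite ler_pM2l ?sparse_const_gt0//.
    by apply: ge0_ler_powR; rewrite ?nnegrE ?(ltW beta_gt0) ?(ltW (r_gt0 _)) ?(ltW k2) ?mulr_ge0 ?(ltW (side_gt0 _)).
  rewrite powRM ?(ltW (side_gt0 _))// mulrA ler_piMl ?powR_ge0//.
  rewrite /sparse_const ler_pdivrMl ?mulr_gt0 ?cube_const_gt0//; lra.
rewrite (_ : (s j `^ beta)%:E = \esum_(i in [set j]) (s i `^ beta)%:E)%E; last first.
  by rewrite esum_set1.
by apply: sub_esum => // _ ->.
Qed.

(** The stopping cells, coded by generation and address: bad cells meeting the cube, with no coarser
    bad cell around the point [x]. *)
Let top (t : nat * 'rV[int]_n) : Prop := exists x, [/\ cube (a, l) x,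
  ad t.1 x = t.2, bad t.1 t.2 & forall k, (k < t.1)%N -> ~ bad k (ad k x)].

Let exists_top k x : cube (a, l) x -> bad k (ad k x) ->
  exists2 k0, (k0 <= k)%N & top (k0, ad k0 x).
Proof.
move=> xQ kb.
have ex : exists k0, `[< bad k0 (ad k0 x) >] by exists k; exact/asboolP.
case: (ex_minnP ex) => k0 /asboolP b0 hmin; exists k0; first by apply: hmin; exact/asboolP.
by exists x; split => // m mk bm; move: mk; rewrite ltnNge hmin//; exact/asboolP.
Qed.

(** If two stopping cells share a vertex [v j], the coarser contains the finer, against the
    maximality of the latter. Their masses therefore add up to at most the total weight. *)
Let cov_inj t t' j : top t -> top t' -> cov t.1 t.2 j -> cov t'.1 t'.2 j -> t = t'.
Proof.
have key u u' : top u -> top u' -> cov u.1 u.2 j -> cov u'.1 u'.2 j -> (u.1 < u'.1)%N -> False.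
  move=> [x [xQ xu bu hu]] [x' [xQ' xu' bu' hu']] [_ ju] [_ ju'] uu'.
  apply: (hu' _ uu'); rewrite (@ad_nest _ u'.1 x' (v j)) ?(ltnW uu')//; last by rewrite ju'.
  by rewrite ju.
move=> tt tt' jt jt'; case: (ltngtP t.1 t'.1) => [h|h|h].
- by case: (key _ _ tt tt' jt jt' h).
- by case: (key _ _ tt' tt jt' jt h).
move: jt jt' => [_ jt] [_ jt']; rewrite h jt' in jt.
by case: t t' h jt {tt tt' jt'} => [? ?] [? ?] /= -> ->.
Qed.

Let sum_top : (\esum_(t in top) (eps * r t.1 `^ beta)%:E <=
  (2 ^+ n * (delta * l `^ beta))%:E)%E.
Proof.
apply: (@le_trans _ _ (\esum_(t in top) mass t.1 t.2)%E).
  by apply: le_esum => t [x []].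
apply: le_trans total_le; apply: esum_disjoint_le => // *; exact: cov_inj.
Qed.

(** For a stopping cell of side [r], [U t] is its open parent cell, sparse because the parent is not
    stopped. [P t] has side [4 r] and is wide enough for every subcube of side at most [r] that
    meets the cell. *)
Lemma stopping_cubes : exists (X : set (nat * 'rV[int]_n))
    (P U : nat * 'rV[int]_n -> 'rV[R]_n * R),
  [/\ forall t, X t -> [/\ 0 < (U t).2, (P t).2 = 2 * (U t).2,
         cube (U t) `<=` cube (P t) & cube (P t) `<=` cube (a, l)],
      forall t, X t -> (H (A `&` cube (U t)) <= ((U t).2 `^ beta / 2)%:E)%E,
      (\esum_(t in X) ((P t).2 `^ beta)%:E <= (l `^ beta / 2)%:E)%E &
      forall S, 0 < S.2 -> cube S `<=` cube (a, l) ->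
        (H (A `&` cube S) <= (S.2 `^ beta / 2)%:E)%E \/
        exists2 t, X t & cube S `<=` cube (P t)].
Proof.
have hP t : exists PU : ('rV[R]_n * R) * ('rV[R]_n * R), top t ->
    [/\ [/\ 0 < PU.2.2, PU.1.2 = 2 * PU.2.2,
         cube PU.2 `<=` cube PU.1 & cube PU.1 `<=` cube (a, l)],
      PU.1.2 = 4 * r t.1,
      (H (A `&` cube PU.2) <= (PU.2.2 `^ beta / 2)%:E)%E &
      forall y S, ad t.1 y = t.2 -> cube S y -> 0 < S.2 -> S.2 <= r t.1 ->
        cube S `<=` cube (a, l) -> cube S `<=` cube PU.1].
  have [tt|] := pselect (top t); last by exists ((0, 0), (0, 0)).
  have [x [xQ xt bt ht]] := tt.
  case: t xt bt ht {tt} => -[|k] z /= xt bt ht; first by have := bad_ge2 bt.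
  have k1 : (1 <= k)%N by exact: bad_ge2 bt.
  have rk : r k = 2 * r k.+1 by rewrite (rB k 1) expn1 addn1.
  have rk1 := r_gt0 k.+1.
  have r4 : 4 * r k.+1 <= l.
    by have := le_r k1; rewrite rk /r expr1; lra.
  (* Centred at [x] with half-side twice the cell: room for the cell itself and for one more cube of
     its size. *)
  pose B : 'rV[R]_n * R := (\row_i (x ord0 i - 2 * r k.+1), 4 * r k.+1).
  have [|P [P2 PQ BP]] := @cube_clamp _ _ (a, l) B l_gt0; first by rewrite /= mulr_gt0.
  rewrite /= min_l// in P2.
  pose U : 'rV[R]_n * R := (\row_i (a ord0 i + r k * (ad k x ord0 i)%:~R), r k).
  (* The grid starts at [a] and its mesh divides [l], so the index of a cell met by the cube lies
     between [0] and [2 ^ k - 1]. *)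
  have UQ : cube U `<=` cube (a, l).
    move=> y yU i; have /andP[y1 y2] := yU i; rewrite /= !mxE in y1 y2.
    have /andP[x1 x2] := xQ i; rewrite /= in x1 x2 *.
    have /andP[] := @adrP _ _ a (r k) x i (r_gt0 k).
    rewrite -/(ad k x) !mxE; set m : int := Num.floor _ => m1 m2.
    have m0 : 0 <= m.
      by rewrite /m floor_ge0 divr_ge0 ?(ltW (r_gt0 k))// subr_ge0 ltW.
    have mu : m + 1 <= (2 ^ k)%N%:Z.
      rewrite lezD1 /m floor_lt_int ltr_pdivrMr// -[X in X * _]/((2 ^ k)%N%:R).
      rewrite natrX /r mulrCA divff ?mulr1 ?expf_neq0//; lra.
    have e1 : 0 <= r k * m%:~R by rewrite mulr_ge0 ?ler0z ?(ltW (r_gt0 k)).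
    have e2 : r k * (m%:~R + 1) <= l.
      have -> : l = r k * (2 ^ k)%N%:R by rewrite /r natrX divfK// expf_neq0.
      by rewrite ler_pM2l//; move: mu; rewrite -(ler_int R) intrD.
    rewrite -/m in y1 y2; rewrite mulrDr mulr1 in e2.
    by apply/andP; split; lra.
  have UB : cube U `<=` cube B.
    move=> y yU i; have /andP[y1 y2] := yU i; rewrite /= !mxE in y1 y2 *.
    have /andP[m1 m2] := @adrP _ _ a (r k) x i (r_gt0 k).
    rewrite mxE in m1 m2.
    by rewrite mulrDr mulr1 in m2; apply/andP; split; lra.
  exists (P, U); split => /=.
  - split; [exact: r_gt0|by rewrite P2 rk; ring| |exact: PQ].
    by move=> y yU; apply: BP; split; [exact: UB|exact: UQ].
  - exact: P2.
  - have ynest y : cube U y -> ad k y = ad k x.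
      move=> yU; apply/rowP => i; have /andP[y1 y2] := yU i.
      rewrite /= !mxE in y1 y2; rewrite /ad !mxE in y1 y2 *.
      apply/floor_def; rewrite intrD ler_pdivlMr// ltr_pdivrMr//.
      by apply/andP; split; lra.
    have nb := ht k (ltnSn k).
    have hcov : A `&` cube U `<=` \bigcup_(j in cov k (ad k x)) dyadic_cube (D j.1).
      move=> y [[i _ iy] yU].
      have [m m1 mb] := exists_bad iy.
      (* A longer [D i] would make a cell coarser than the parent bad, against the maximality of the
         stopping cell. *)
      have sk : side (D i) <= r k.
        rewrite leNgt; apply/negP => h; have mk : (m < k)%N by apply: lt_r; exact: lt_le_trans m1.
        apply: (ht m (ltnW mk)); rewrite -(ad_nest (ltnW mk) (ynest y yU)).
        exact: mb.
      have [j jk ji] := exists_cov iy sk; exists j; last by rewrite ji.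
      by rewrite -(ynest y yU).
    apply: le_trans (content_le_esum beta_gt0 hcov) _.
    move: nb => /negP; rewrite -ltNge => /ltW/le_trans; apply.
    rewrite lee_fin mulrC ler_pM2l ?powR_gt0//.
    have [c1 _ _] := cube_const_ge.
    by rewrite /sparse_const lef_pV2 ?posrE ?mulr_gt0 ?cube_const_gt0//; lra.
  - move=> y S yz Sy S0 Sr SQ; apply: subset_trans BP => w Sw; split; last exact: SQ.
    move=> i; rewrite /= mxE; rewrite -xt in yz.
    have /andP[m1 m2] := @adrP _ _ a (r k.+1) x i rk1.
    have /andP[m3 m4] := @adrP _ _ a (r k.+1) y i rk1.
    rewrite -/(ad _ _) yz /ad in m3 m4; rewrite mulrDr mulr1 in m2 m4.
    have /andP[w1 w2] := Sw i; have /andP[w3 w4] := Sy i.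
    by apply/andP; split; lra.
have {hP}[PU hPU] := choice hP.
exists top, (fst \o PU), (snd \o PU); split.
- by move=> t /hPU[].
- by move=> t /hPU[].
- have C00 := @cube_const_gt0 R n beta; have [c1 c2 c3] := cube_const_ge.
  have e0 := sparse_const_gt0; have p4 : 0 < 4 `^ beta :> R by rewrite powR_gt0.
  have lb : 0 < l `^ beta by rewrite powR_gt0.
  apply: (@le_trans _ _ ((4 `^ beta / eps)%:E * \esum_(t in top) (eps * r t.1 `^ beta)%:E)%E).
    have q0 : 0 <= 4 `^ beta / eps by rewrite divr_ge0 ?ltW.
    apply: le_trans (esumZl_le top q0 _) => [|t]; last first.
      by rewrite lee_fin mulr_ge0 ?powR_ge0// ltW.
    apply: le_esum => t /hPU[_ h _ _]; rewrite /= h -EFinM lee_fin.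
    by rewrite powRM ?(ltW (r_gt0 _))// mulrA divfK ?gt_eqF.
  apply: (@le_trans _ _ ((4 `^ beta / eps)%:E * (2 ^+ n * (delta * l `^ beta))%:E)%E).
    by rewrite lee_wpmul2l// lee_fin divr_ge0 ?ltW.
  rewrite -EFinM lee_fin /cover_const.
  rewrite (_ : _ * _ = (2 ^+ n / C0) * (l `^ beta / 2)); last by field; rewrite !gt_eqF.
  by rewrite ler_piMl ?divr_ge0 ?(ltW lb)// ler_pdivrMr// mul1r.
- move=> S S0 SQ.
  have [k /andP[k1 k2]] : exists k : nat, S.2 <= r k < 2 * S.2.
    by apply: exists_scale => //; exact: (@side_le_of_sub _ _ (a, l) S).
  (* If a point of [S] lies in a bad cell of side at least [r k], the maximal one around it is at
     least as long as [S], so that its [P t] contains [S]. *)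
  have [hS|hS] := pselect (exists2 m, (m <= k)%N & exists2 x, cube S x & bad m (ad m x)).
    have [m mk [x Sx bx]] := hS.
    have [m0 m0m mt] := exists_top (SQ _ Sx) bx.
    right; exists (m0, ad m0 x) => //=.
    have [_ _ _ hh] := hPU _ mt; apply: (hh x) => //.
    by apply: le_trans k1 _; apply: le_r; exact: leq_trans mk.
  left.
  (* Otherwise [S] is split among the at most [2 ^ n] cells of its vertices. Each piece has content
     at most [eps * r k ^ beta], and [eps] is set so that the sum is at most [S.2 ^ beta / 2]. *)
  pose E (e : {ffun 'I_n -> bool}) := [set y | [/\ A y, cube S y & ad k y = ad k (vert S.1 S.2 e)]].
  have hE : A `&` cube S `<=` \bigcup_(e in [set: {ffun 'I_n -> bool}]) E e.
    move=> y [Ay Sy]; have [|e he] := @exists_vert _ _ a (r k) S.1 S.2 y (r_gt0 k) k1.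
      by move=> i; have /andP[/ltW -> /ltW ->] := Sy i.
    by exists e.
  apply: le_trans (content_sub beta_gt0 hE) _.
  apply: (@le_trans _ _ (\esum_(e in [set: {ffun 'I_n -> bool}]) (eps * r k `^ beta)%:E)%E).
    apply: le_esum => e _.
    have [->|/set0P[y [Ay Sy ye]]] := eqVneq (E e) set0.
      by rewrite content0// lee_fin mulr_ge0 ?powR_ge0 ?(ltW sparse_const_gt0).
    have nb : ~ bad k (ad k y) by move=> b; apply: hS; exists k => //; exists y.
    have hcov : E e `<=` \bigcup_(j in cov k (ad k y)) dyadic_cube (D j.1).
      move=> y' [[i _ iy] Sy' ye'].
      have [m m1 mb] := exists_bad iy.
      have sk : side (D i) <= r k.
        rewrite leNgt; apply/negP => h; apply: hS; exists m; last by exists y'.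
        by apply: ltnW; apply: lt_r; exact: lt_le_trans m1.
      have [j jk ji] := exists_cov iy sk; exists j; last by rewrite ji.
      by rewrite ye -ye'.
    apply: le_trans (content_le_esum beta_gt0 hcov) _.
    by move: nb => /negP; rewrite -ltNge => /ltW.
  rewrite esum_finType; last by move=> _; rewrite lee_fin mulr_ge0 ?powR_ge0 ?(ltW sparse_const_gt0).
  rewrite sumEFin sumr_const card_ffun card_bool card_ord lee_fin.
  rewrite -[leLHS]mulr_natl natrX.
  have e0 := sparse_const_gt0.
  have Sb : r k `^ beta <= 2 `^ beta * S.2 `^ beta.
    rewrite -powRM ?(ltW S0)//.
    by apply: ge0_ler_powR; rewrite ?nnegrE ?(ltW beta_gt0) ?(ltW (r_gt0 _)) ?(ltW k2) ?mulr_ge0 ?(ltW S0).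
  apply: (@le_trans _ _ (2 ^+ n * (eps * (2 `^ beta * S.2 `^ beta)))).
    by rewrite !ler_pM2l ?exprn_gt0.
  rewrite le_eqVlt; apply/orP; left; apply/eqP; rewrite /sparse_const /cube_const.
  by field; rewrite !gt_eqF ?exprn_gt0 ?powR_gt0.
Qed.

End stopping.

(** * Exponential decay and the maximal function *)

Section oscillation_decay.
Context {R : realType} {n : nat} (beta : R).
Hypothesis n_gt0 : (0 < n)%N.
Hypothesis beta_gt0 : 0 < beta.
Hypothesis beta_le : beta <= n%:R.
Context (Q : set 'rV[R]_n) (f : 'rV[R]_n -> R).
Context (K : R) (c : 'rV[R]_n * R -> R).
Hypothesis K_gt0 : 0 < K.
Hypothesis hc : forall P, subcubes Q P ->
  (choquet beta (cube P) (fun x => `|f x - c P|%:E) <= (K * P.2 `^ beta)%:E)%E.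
Implicit Types P S : 'rV[R]_n * R.
Local Notation H := (@dyadic_content R n beta).
Local Notation C0 := (@cube_const R n beta).
Local Notation delta := (@cover_const R n beta).

(** Level sets of the supremum of [|c S - c P|], which takes the place of [|f - c P|] in the
    John-Nirenberg iteration. *)
Definition osc P (t : R) : set 'rV[R]_n := [set x | cube P x /\
  exists S, [/\ 0 < S.2, cube S x, cube S `<=` cube P & t < `|c S - c P| :> R]].

(** The cost, in units of [K], of one stopping step: [2 / delta + 3] from the cube to the parent
    cell, then [2 * 2 ^ beta + 3] from there to the enlarged cell. *)
Definition osc_gap : R := 2 / delta + 6 + 2 * 2 `^ beta.

Lemma osc_gap_gt0 : 0 < osc_gap.
Proof.
have d0 : 0 < 2 / delta by rewrite divr_gt0// cover_const_gt0.
have p2 : 0 < 2 `^ beta :> R by rewrite powR_gt0.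
by rewrite /osc_gap; lra.
Qed.

(** A cube with a far centre lies in some enlarged stopping cell, whose own centre has moved by at
    most [osc_gap * K]; an oscillation above [t] remains inside that cell. The factor one half is
    the total weight of the cells. *)
Lemma osc_step (phi t : R) : 0 <= phi -> 0 <= t ->
  (forall P, subcubes Q P -> (H (osc P t) <= (phi * P.2 `^ beta)%:E)%E) ->
  forall P, subcubes Q P ->
    (H (osc P (t + osc_gap * K)) <= (phi / 2 * P.2 `^ beta)%:E)%E.
Proof.
move=> phi0 t0 IH [a l] hP; have K0 := K_gt0; have [/= l0 PQ] := hP.
have d0 : 0 < delta by exact: cover_const_gt0.
have lb : 0 < l `^ beta by rewrite powR_gt0.
have p2 : 0 < 2 `^ beta :> R by rewrite powR_gt0.
(* Chebyshev at this level gives content at most [delta / 2 * l ^ beta], strictly below what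
   [stopping_cubes] requires, so a cover can be extracted. *)
pose L : R := 2 * K / delta; have L0 : 0 < L by rewrite divr_gt0// mulr_gt0.
have gapE : osc_gap * K = L + 6 * K + 2 * 2 `^ beta * K.
  by rewrite /osc_gap /L; field; rewrite gt_eqF.
have pK : 0 < 2 `^ beta * K by rewrite mulr_gt0.
pose A0 := [set x | cube (a, l) x /\ L < `|f x - c (a, l)|].
have : (H A0 < (delta * l `^ beta)%:E)%E.
  apply: le_lt_trans (far_content hc L0 hP) _; rewrite lte_fin /=.
  rewrite (_ : _ / L = delta / 2 * l `^ beta); last by rewrite /L; field; rewrite !gt_eqF.
  by rewrite ltr_pM2r//; lra.
move=> /ereal_inf_lt[_ [D hD <-] sumD].
have [X [P [U [hPU hU sumP hS]]]] := stopping_cubes n_gt0 beta_gt0 a l0 sumD.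
have sparse S : (H (\bigcup_i dyadic_cube (D i) `&` cube S) <= (S.2 `^ beta / 2)%:E)%E ->
    subcubes Q S -> cube S `<=` cube (a, l) -> `|c S - c (a, l)| <= L + 3 * K.
  move=> hAS SQ SP; apply: (close_of_sparse beta_gt0 beta_le K_gt0 hc) => //.
  by apply: le_trans hAS; apply: le_content; exact: setSI.
have sub : osc (a, l) (t + osc_gap * K) `<=` \bigcup_(u in X) osc (P u) t.
  move=> x [xP [S [S0 Sx SP tS]]].
  have SQ : subcubes Q S by split => //; exact: subset_trans PQ.
  case: (hS S S0 SP) => [hAS|[u Xu Su]].
    by exfalso; have := sparse _ hAS SQ SP; move: tS; rewrite gapE; lra.
  have [U0 PU UP PP] := hPU u Xu.
  have PuQ : subcubes Q (P u).
    by split; [rewrite PU mulr_gt0|exact: subset_trans PQ].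
  have UuQ : subcubes Q (U u).
    by split => //; apply: subset_trans PQ; exact: subset_trans PP.
  exists u => //; split; first exact: Su.
  exists S; split => //.
  have h1 := sparse _ (hU u Xu) UuQ (subset_trans UP PP).
  have h2 : `|c (U u) - c (P u)| <= 2 * 2 `^ beta * K + 3 * K.
    by apply: (close_of_ratio beta_gt0 beta_le K_gt0 hc) => //; rewrite PU.
  have h3 : `|c S - c (a, l)| <= `|c S - c (P u)| + `|c (U u) - c (P u)| + `|c (U u) - c (a, l)|.
    rewrite (distrC (c (U u)) (c (P u))).
    apply: le_trans (ler_distD (c (U u)) _ _) _; rewrite lerD2r.
    exact: ler_distD.
  by move: tS; rewrite gapE; lra.
apply: le_trans (content_sub beta_gt0 sub) _.
apply: (@le_trans _ _ (\esum_(u in X) (phi%:E * ((P u).2 `^ beta)%:E))%E).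
  apply: le_esum => u Xu; rewrite -EFinM; apply: IH; have [U0 PU UP PP] := hPU u Xu.
  by split; [rewrite PU mulr_gt0|exact: subset_trans PQ].
apply: le_trans (esumZl_le X phi0 _) _; first by move=> u; rewrite lee_fin powR_ge0.
rewrite (_ : (phi / 2 * _)%:E = (phi%:E * (l `^ beta / 2)%:E)%E); last first.
  by rewrite -EFinM mulrAC mulrA.
by rewrite lee_wpmul2l ?lee_fin.
Qed.

Lemma osc_decay m P : subcubes Q P ->
  (H (osc P (m%:R * (osc_gap * K))) <= (C0 / 2 ^+ m * P.2 `^ beta)%:E)%E.
Proof.
elim: m P => [|m IH] P hP.
  rewrite expr0 divr1; apply: le_trans (content_cube_le beta_gt0 hP.1).
  by apply: le_content => x [].
rewrite -natr1 mulrDl mul1r.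
rewrite (_ : C0 / 2 ^+ m.+1 = C0 / 2 ^+ m / 2); last by rewrite exprSr invfM mulrA.
apply: osc_step => //.
- by rewrite divr_ge0 ?exprn_ge0 ?(ltW (cube_const_gt0 _)).
- by rewrite !mulr_ge0 ?(ltW osc_gap_gt0) ?(ltW K_gt0).
Qed.

End oscillation_decay.

(** * Lower oscillation of the maximal function on a subcube *)

Section maximal_lower_oscillation.
Context {R : realType} {n : nat} (beta : R).
Hypothesis n_gt0 : (0 < n)%N.
Hypothesis beta_gt0 : 0 < beta.
Hypothesis beta_le : beta <= n%:R.
Context (Q : set 'rV[R]_n) (f : 'rV[R]_n -> R).
Hypothesis hQ : (exists a l, 0 < l /\ Q = cube (a, l)) \/ Q = [set: 'rV[R]_n].
Hypothesis f_L1 : (choquet beta Q (fun x => `|f x|%:E) < +oo)%E.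
Context (K : R) (c : 'rV[R]_n * R -> R).
Hypothesis K_gt0 : 0 < K.
Hypothesis hc : forall P, subcubes Q P ->
  (choquet beta (cube P) (fun x => `|f x - c P|%:E) <= (K * P.2 `^ beta)%:E)%E.
Implicit Types P S : 'rV[R]_n * R.
Local Notation H := (@dyadic_content R n beta).
Local Notation C0 := (@cube_const R n beta).
Local Notation F := (patch (fun=> 0) Q f).
Local Notation gap := (@osc_gap R n beta).

Lemma subcube_clamp S : 0 < S.2 ->
  exists P, [/\ subcubes Q P, P.2 <= S.2 & cube S `&` Q `<=` cube P].
Proof.
move=> S0; case: hQ => [[a [l [l0 ->]]]|->]; last first.
  by exists S; split => // x [].
have [P [P2 PQ SP]] := @cube_clamp _ _ (a, l) S l0 S0.
exists P; split => //; last by rewrite P2 ge_min lexx.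
by split => //; rewrite P2 lt_min S0 l0.
Qed.

Definition enlarge S : 'rV[R]_n * R := (\row_i (S.1 ord0 i - S.2), 3 * S.2).

Lemma sub_enlarge P S x : cube P x -> cube S x -> P.2 <= S.2 ->
  cube P `<=` cube (enlarge S).
Proof.
move=> Px Sx PS y Py i; rewrite /= mxE.
have /andP[? ?] := Px i; have /andP[? ?] := Sx i; have /andP[? ?] := Py i.
by apply/andP; split; lra.
Qed.

(** Moves the averaging cube into [W] without lowering the average, since the part of [S] carrying
    [F] already lies in [W]. *)
Lemma avg_clamp W S x : subcubes Q W -> 0 < S.2 -> cube S `&` Q `<=` cube W ->
  cube S x -> cube W x ->
  exists P, [/\ subcubes Q P, cube P `<=` cube W, cube P x, P.2 = Num.min S.2 W.2 &
                (avg F S <= avg F P)%E].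
Proof.
move=> [W0 WQ] S0 SW Sx Wx; have [P [P2 PW SP]] := cube_clamp W0 S0.
have P0 : 0 < P.2 by rewrite P2 lt_min S0 W0.
exists P; split => //.
- by split => //; exact: subset_trans WQ.
- exact: SP.
- apply: avg_patch_le => //; first by rewrite P2 ge_min lexx.
  by move=> y [Sy Qy]; apply: SP; split => //; exact: SW.
Qed.

Lemma avg_small (Q0 N : 'rV[R]_n * R) S x t : subcubes Q Q0 -> subcubes Q N ->
  cube (enlarge Q0) `&` Q `<=` cube N -> cube Q0 x -> ~ osc c N t x ->
  0 < S.2 -> cube S x -> S.2 <= Q0.2 -> (avg F S <= (`|c N| + 3 * K + t)%:E)%E.
Proof.
move=> hQ0 hN QN Q0x xt S0 Sx SQ.
have SN : cube S `&` Q `<=` cube N.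
  by move=> y [Sy Qy]; apply: QN; split => //; exact: (sub_enlarge Sx Q0x).
have Nx : cube N x by apply: SN; split => //; exact: hQ0.2.
have K0 := K_gt0; have [P [hP PN Px P2 avgP]] := avg_clamp hN S0 SN Sx Nx.
apply: (le_trans avgP); apply: le_trans (avg_le beta_gt0 beta_le K_gt0 hc hP) _.
rewrite lee_fin; have : `|c P - c N| <= t.
  rewrite leNgt; apply/negP => h; apply: xt; split => //.
  by exists P; split => //; exact: hP.1.
have := ler_normD (c P - c N) (c N); rewrite subrK; lra.
Qed.

(** [W] is the triple of [S] fitted into [Q]. The clamped copy of [S] has at least a third of its
    side, so [close_of_ratio] applies with ratio 3. *)
Lemma avg_large (Q0 : 'rV[R]_n * R) S x : subcubes Q Q0 -> cube Q0 x ->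
  0 < S.2 -> cube S x -> Q0.2 <= S.2 ->
  exists W, [/\ subcubes Q W, cube Q0 `<=` cube W &
    (avg F S <= (`|c W| + (6 + 2 * 3 `^ beta) * K)%:E)%E].
Proof.
move=> hQ0 Q0x S0 Sx QS.
have [|W [hW W2 SW]] := @subcube_clamp (enlarge S); first by rewrite mulr_gt0.
have QW : cube Q0 `<=` cube W.
  move=> y Qy; apply: SW; split; last exact: hQ0.2.
  exact: (sub_enlarge Q0x Sx).
have SW' : cube S `&` Q `<=` cube W.
  move=> y [Sy Qy]; apply: SW; split => //; exact: (sub_enlarge Sx Sx).
have [P [hP PW Px P2 avgP]] := avg_clamp hW S0 SW' Sx (QW _ Q0x).
exists W; split => //; have K0 := K_gt0.
apply: (le_trans avgP); apply: le_trans (avg_le beta_gt0 beta_le K_gt0 hc hP) _.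
rewrite lee_fin; have : `|c P - c W| <= 2 * 3 `^ beta * K + 3 * K.
  apply: (close_of_ratio beta_gt0 beta_le K_gt0 hc) => //.
  by have W0 := hW.1; rewrite P2 minr_pMr// le_min; apply/andP; split; [exact: W2|lra].
have := ler_normD (c P - c W) (c W); rewrite subrK; lra.
Qed.

Section fixed_cube.
Context (Q0 : 'rV[R]_n * R).
Hypothesis hQ0 : subcubes Q Q0.
Local Notation M := (maximal F).
Local Notation m := (ess_inf_content beta (cube Q0) M).

Let Q00 : 0 < Q0.2. Proof. exact: hQ0.1. Qed.

(** [P] is an admissible cube for the maximal function at every point of [Q0], so the sublevel set
    is empty. *)
Lemma ess_inf_ge P : subcubes Q P -> cube Q0 `<=` cube P ->
  ((`|c P| - 3 * K)%:E <= m)%E.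
Proof.
move=> hP QP; apply: ereal_sup_ubound; exists (`|c P| - 3 * K) => //=.
rewrite (_ : [set _ | _] = set0) ?content0//.
apply/seteqP; split => // x [/QP Px]; apply/negP; rewrite -leNgt.
apply: le_trans (avg_ge beta_gt0 beta_le K_gt0 hc hP) _.
by apply: maximal_ge => //; exact: hP.1.
Qed.

(** The integrability of [f] bounds its average over [P] by a multiple of [P.2 ^ (- beta)], and
    cubes containing [Q0] are at least as long as [Q0]. *)
Lemma center_le : exists B, forall P, subcubes Q P -> cube Q0 `<=` cube P -> `|c P| <= B.
Proof.
have [X X0 fX] : exists2 X, 0 < X & (choquet beta Q (fun x => `|f x|%:E) <= X%:E)%E.
  exists (fine (choquet beta Q (fun x => `|f x|%:E)) + 1).
    by rewrite ltr_wpDl// fine_ge0// choquet_ge0.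
  rewrite EFinD fineK ?leeDl// ge0_fin_numE ?choquet_ge0//.
exists (3 * (Q0.2 `^ (- beta) * X) + 3 * K) => P hP QP; have P0 := hP.1.
have := le_trans (avg_ge beta_gt0 beta_le K_gt0 hc hP) (avg_le_choquet beta_gt0 beta_le X0 hP fX).
rewrite lee_fin; suff : P.2 `^ (- beta) <= Q0.2 `^ (- beta).
  by move=> h; have := ler_wpM2r (ltW X0) h; lra.
rewrite !powRN lef_pV2 ?posrE ?powR_gt0//.
apply: ge0_ler_powR; rewrite ?nnegrE ?(ltW beta_gt0) ?(ltW Q00) ?(ltW P0)//.
exact: side_le_of_sub QP.
Qed.

Lemma exists_neighbourhood : exists N, [/\ subcubes Q N, cube Q0 `<=` cube N,
  N.2 <= 3 * Q0.2 & cube (enlarge Q0) `&` Q `<=` cube N].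
Proof.
have [|N [hN N2 QN]] := @subcube_clamp (enlarge Q0); first by rewrite mulr_gt0.
exists N; split => // y Qy; apply: QN; split; last exact: hQ0.2.
exact: (sub_enlarge Qy Qy).
Qed.

Lemma osc_neighbourhood N j : subcubes Q N -> N.2 <= 3 * Q0.2 ->
  (H (osc c N (j%:R * (gap * K))) <= (C0 * 3 `^ beta * Q0.2 `^ beta / 2 ^+ j)%:E)%E.
Proof.
move=> hN N3; apply: le_trans (osc_decay n_gt0 beta_gt0 beta_le K_gt0 hc j hN) _.
rewrite lee_fin mulrAC ler_pM2r ?invr_gt0 ?exprn_gt0// -mulrA ler_pM2l ?cube_const_gt0//.
rewrite -powRM ?(ltW Q00)//; have N0 := hN.1.
by apply: ge0_ler_powR; rewrite ?nnegrE ?(ltW beta_gt0) ?(ltW N0) ?mulr_ge0 ?(ltW Q00).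
Qed.

(** Off a set too small to cover [Q0] the maximal function is at most [Bd]; a larger essential
    infimum would make the rest of [Q0] null. *)
Lemma ess_inf_fin : m \is a fin_num.
Proof.
have K0 := K_gt0; have [N [hN QN N3 NE]] := exists_neighbourhood; have [B hB] := center_le.
have C00 := @cube_const_gt0 R n beta; have qb : 0 < Q0.2 `^ beta by rewrite powR_gt0.
have p3 : 0 < 3 `^ beta :> R by rewrite powR_gt0.
rewrite fin_numE; apply/andP; split.
  by rewrite -ltNye; apply: lt_le_trans (ess_inf_ge hN QN); rewrite ltNyr.
(* Then [2 ^ j > C0 * 3 ^ beta], which brings the content of [osc] below that of [Q0]. *)
pose j := (Num.truncn (C0 * 3 `^ beta)).+1.
have hj : (H (osc c N (j%:R * (gap * K))) < (Q0.2 `^ beta)%:E)%E.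
  apply: le_lt_trans (osc_neighbourhood j hN N3) _.
  rewrite lte_fin ltr_pdivrMr ?exprn_gt0// mulrC ltr_pM2l//.
  apply: lt_le_trans (truncnS_gt _) _; rewrite -natrX ler_nat.
  by apply: ltnW; exact: ltn_expl.
set t := j%:R * (gap * K) in hj.
have t0 : 0 <= t by rewrite !mulr_ge0 ?(ltW K_gt0) ?(ltW (osc_gap_gt0 _)).
pose Bd : R := B + (6 + 2 * 3 `^ beta) * K + t.
rewrite -ltey; apply: (@le_lt_trans _ _ Bd%:E); last exact: ltry.
apply: ge_ereal_sup => _ [b hb <-]; rewrite lee_fin leNgt; apply/negP => Bb.
have : (H (cube Q0) <= H (osc c N t) + 0)%E.
  rewrite -[in X in (_ + X)%E]hb; apply: le_trans (contentU beta_gt0 _ _).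
  apply: le_content => x Qx; have [xt|xt] := pselect (osc c N t x); [by left|right].
  split => //; apply: (@le_lt_trans _ _ Bd%:E); last by rewrite lte_fin.
  apply: maximal_le => S S0 Sx; have [SQ|/ltW SQ] := leP S.2 Q0.2.
    apply: le_trans (avg_small hQ0 hN NE Qx xt S0 Sx SQ) _.
    have := hB N hN QN; have := mulr_gt0 p3 K_gt0; rewrite lee_fin /Bd; lra.
  have [W [hW QW /le_trans]] := avg_large hQ0 Qx S0 Sx SQ; apply.
  by have := hB W hW QW; rewrite lee_fin /Bd; lra.
rewrite adde0 => /(le_trans (content_cube_ge beta_gt0 beta_le Q00)).
by rewrite leNgt hj.
Qed.

(** [6 + 2 * 3 ^ beta] from [avg_large] plus the [3] lost in [ess_inf_ge]; this also covers
    [avg_small]. *)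
Definition lower_const : R := 9 + 2 * 3 `^ beta.

Lemma maximal_sub_osc N t : subcubes Q N -> cube Q0 `<=` cube N ->
  cube (enlarge Q0) `&` Q `<=` cube N -> 0 <= t ->
  [set x | cube Q0 x /\ ((lower_const * K + t)%:E < M x - m)%dE] `<=` osc c N t.
Proof.
move=> hN QN NE t0 x [Qx]; apply: contraPP => xt; apply/negP; rewrite -leNgt.
have K0 := K_gt0; have mE := fineK ess_inf_fin; set mu := fine m in mE.
have p3 : 0 < 3 `^ beta * K by rewrite mulr_gt0 ?powR_gt0.
have hm P : subcubes Q P -> cube Q0 `<=` cube P -> `|c P| - 3 * K <= mu.
  by move=> hP QP; have := ess_inf_ge hP QP; rewrite -mE lee_fin.
have : (M x <= (mu + lower_const * K + t)%:E)%E.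
  apply: maximal_le => S S0 Sx; have [SQ|/ltW SQ] := leP S.2 Q0.2.
    apply: le_trans (avg_small hQ0 hN NE Qx xt S0 Sx SQ) _.
    have := hm N hN QN; rewrite lee_fin /lower_const; lra.
  have [W [hW QW /le_trans]] := avg_large hQ0 Qx S0 Sx SQ; apply.
  by have := hm W hW QW; rewrite lee_fin /lower_const; lra.
rewrite -mE; case: (M x) => [g| |] //=; last by move=> _; rewrite leNye.
by rewrite !lee_fin; lra.
Qed.

(** The mesh of the upper sum times the sum of the geometric series of contents, both stripped of
    [K] and [Q0.2 ^ beta]. *)
Definition main_const : R := (lower_const + gap) * (2 * C0 * 3 `^ beta).

Lemma main_const_gt0 : 0 < main_const.
Proof.
have p3 : 0 < 3 `^ beta :> R by rewrite powR_gt0.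
rewrite mulr_gt0 ?mulr_gt0 ?cube_const_gt0// addr_gt0 ?osc_gap_gt0//.
by rewrite /lower_const; lra.
Qed.

Lemma choquet_maximal_le :
  (choquet beta (cube Q0) (fun x => (M x - m)%dE) <=
   (main_const * K * Q0.2 `^ beta)%:E)%E.
Proof.
have K0 := K_gt0; have [N [hN QN N3 NE]] := exists_neighbourhood.
have p3 : 0 < 3 `^ beta :> R by rewrite powR_gt0.
have g0 : 0 < gap by exact: osc_gap_gt0.
have l0 : 0 < lower_const by rewrite /lower_const; lra.
have e0 : 0 < (lower_const + gap) * K by exact: (mulr_gt0 (addr_gt0 l0 g0) K0).
pose B : R := 2 * (C0 * 3 `^ beta * Q0.2 `^ beta).
have B0 : 0 <= B by rewrite !mulr_ge0 ?powR_ge0 ?(ltW (cube_const_gt0 _)).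
apply: le_trans (choquet_le_series beta _ _ e0) _.
rewrite (_ : main_const * K * _ = (lower_const + gap) * K * B); last first.
  by rewrite /main_const /B; ring.
rewrite (EFinM _ B) lee_pmul2l ?lte_fin//.
apply: le_trans (epsilon_trick0 xpredT B0).
apply: lee_nneseries => [j _ _|j _]; first exact: content_ge0.
have -> : B / (2 ^ j.+1)%:R = C0 * 3 `^ beta * Q0.2 `^ beta / 2 ^+ j.
  by rewrite /B natrX exprS; field; rewrite expf_neq0.
(* The level [0] term is bounded by the content of [Q0]; the later ones by the decay of [osc]. *)
case: j => [|j].
  rewrite expr0 divr1; apply: (@le_trans _ _ (C0 * Q0.2 `^ beta)%:E).
    by apply: le_trans (content_cube_le beta_gt0 Q00); apply: le_content => x [].
  rewrite lee_fin -mulrA ler_pM2l ?cube_const_gt0// ler_peMl ?powR_ge0//.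
  by rewrite powR_ge1// ler1n.
apply: le_trans (osc_neighbourhood j.+1 hN N3); apply: le_content => x [Qx hx].
apply: maximal_sub_osc => //; first by rewrite !mulr_ge0 ?(ltW K_gt0) ?(ltW g0).
split => //; apply: le_lt_trans hx; rewrite lee_fin.
(* Each level is a multiple of [(lower_const + gap) * K]; one copy of [lower_const * K] suffices for
   the comparison with [osc]. *)
rewrite [X in _ <= _ * X]mulrDl mulrDr lerD2r ler_peMl ?ler1n//.
by rewrite mulr_ge0 ?ltW.
Qed.

End fixed_cube.
End maximal_lower_oscillation.

(** * From bounds on single cubes to the norms *)

Section norms.
Context {R : realType} {n : nat} (beta : R).
Hypothesis n_gt0 : (0 < n)%N.
Hypothesis beta_gt0 : 0 < beta.
Hypothesis beta_le : beta <= n%:R.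
Context (Q : set 'rV[R]_n) (f : 'rV[R]_n -> R).
Hypothesis hQ : (exists a l, 0 < l /\ Q = cube (a, l)) \/ Q = [set: 'rV[R]_n].
Local Notation H := (@dyadic_content R n beta).
Local Notation C0 := (@cube_const R n beta).
Local Open Scope ereal_scope.

Lemma content_cube_fin (P : 'rV[R]_n * R) : (0 < P.2)%R ->
  H (cube P) \is a fin_num /\ (0 < fine (H (cube P)))%R.
Proof.
move=> P0; have pb : (0 < P.2 `^ beta)%R by rewrite powR_gt0.
have h1 := content_cube_ge beta_gt0 beta_le P0.
have h2 : H (cube P) \is a fin_num.
  by rewrite ge0_fin_numE ?content_ge0// (le_lt_trans (content_cube_le beta_gt0 P0))// ltry.
split=> //; rewrite -lte_fin fineK//.
by apply: lt_le_trans h1; rewrite lte_fin.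
Qed.

Lemma BMO_norm_ge0 : 0 <= BMO_norm beta Q f.
Proof.
have [P hP] : exists P, subcubes Q P.
  case: hQ => [[a [l [l0 ->]]]|->]; first by exists (a, l); split.
  by exists (0%R, 1%R); split => //=; exact: ltr01.
apply: le_ereal_sup_tmp; eexists; first by exists P.
apply: le_ereal_inf_tmp => _ [c _ <-].
have [h1 h2] := content_cube_fin hP.1.
by rewrite mule_ge0 ?inve_ge0 ?content_ge0 ?choquet_ge0.
Qed.

Lemma exists_centers (k : R) : BMO_norm beta Q f < k%:E ->
  exists c, forall P, subcubes Q P ->
    choquet beta (cube P) (fun x => `|f x - c P|%:E) <= (k * C0 * P.2 `^ beta)%:E.
Proof.
move=> fk; have k0 : (0 <= k)%R by rewrite -lee_fin (le_trans BMO_norm_ge0)// ltW.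
suff : forall P, exists c, subcubes Q P ->
    choquet beta (cube P) (fun x => `|f x - c|%:E) <= (k * C0 * P.2 `^ beta)%:E.
  by move=> /choice[c hc]; exists c.
move=> P; have [hP|] := pselect (subcubes Q P); last by exists 0%R.
have : ereal_inf [set (H (cube P))^-1 * choquet beta (cube P) (fun x => `|f x - c|%:E)
     | c in [set: R]] < k%:E.
  by apply: le_lt_trans fk; apply: ereal_sup_ubound; exists P.
move=> /ereal_inf_lt[_ [c _ <-] hc]; exists c => _.
have [h1 h2] := content_cube_fin hP.1.
move: hc; rewrite -(fineK h1) inver gt_eqF// lte_pdivrMl// => /ltW/le_trans; apply.
rewrite muleC fineK// -mulrA EFinM lee_wpmul2l ?lee_fin//.
exact: content_cube_le hP.1.
Qed.

Lemma BLO_norm_maximal_le (k : R) : BMO beta Q f -> BMO_norm beta Q f < k%:E ->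
  BLO_norm beta Q (maximal (patch (fun=> 0%R) Q f)) <=
  (@main_const R n beta * C0 * k)%:E.
Proof.
move=> [[_ fL1] _] fk; have k0 : (0 < k)%R by rewrite -lte_fin (le_lt_trans BMO_norm_ge0).
have [c hc] := exists_centers fk.
have K0 : (0 < k * C0)%R by rewrite mulr_gt0 ?cube_const_gt0.
apply: ge_ereal_sup => _ [P hP <-].
have [h1 h2] := content_cube_fin hP.1.
have h3 := content_cube_ge beta_gt0 beta_le hP.1.
rewrite -(fineK h1) inver gt_eqF// lee_pdivrMl//.
apply: le_trans (choquet_maximal_le n_gt0 beta_gt0 beta_le hQ fL1 K0 hc hP) _.
rewrite -[in leRHS]mulrA (mulrC C0) muleC EFinM lee_wpmul2l//; last by rewrite fineK.
by rewrite lee_fin mulr_ge0 ?(ltW K0) ?(ltW (main_const_gt0 _)).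
Qed.

End norms.

Theorem theorem1p3 (R : realType) (n : nat) (beta : R) :
  0 < beta <= n%:R ->
  exists C : R, 0 < C /\
    forall Q : set 'rV[R]_n,
      (exists a l, 0 < l /\ Q = cube (a, l)) \/ Q = [set: 'rV[R]_n] ->
      forall f : 'rV[R]_n -> R, BMO beta Q f ->
        (BLO_norm beta Q (maximal (patch (fun=> 0%R) Q f)) <= C%:E * BMO_norm beta Q f)%E.
Proof.
move=> /andP[beta_gt0 beta_le].
have n_gt0 : (0 < n)%N by rewrite -(ltr0n R) (lt_le_trans beta_gt0).
exists (@main_const R n beta * @cube_const R n beta).
have C_gt0 : 0 < @main_const R n beta * @cube_const R n beta.
  by rewrite mulr_gt0 ?cube_const_gt0 ?main_const_gt0.
split=> // Q hQ f hf; have f0 := @BMO_norm_ge0 R n beta beta_gt0 beta_le Q f hQ.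
have ffin : BMO_norm beta Q f \is a fin_num by rewrite ge0_fin_numE//; case: hf.
(* Centres exist only for a bound strictly above the BMO norm, which may be zero or not attained;
   [e / C] is the excess that costs [e] in the end. *)
apply/lee_addgt0Pr => e e0; set C := _ * _ in C_gt0 *.
have eC : 0 < e / C by rewrite divr_gt0.
have := @BLO_norm_maximal_le R n beta n_gt0 beta_gt0 beta_le Q f hQ (fine (BMO_norm beta Q f) + e / C) hf.
move=> /(_ _)/le_trans; apply.
  by rewrite EFinD fineK// lteDl// lte_fin.
by rewrite -/C mulrDr mulrCA divff ?gt_eqF// mulr1 EFinD EFinM fineK.
Qed.
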